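(* Let $D\in\mathbb{R}^{n\times n}$ be symmetric and let $V=D$ or $V=-D$. A probability measure $\mu\in\mathcal{P}(\mathcal{S})$ is a stationary solution of the continuity equation $\partial_t\mu+\operatorname{div}(\mathsf{V}[\mu]\mu)=0$ on $\mathcal{S}$ with velocity field $$\mathsf{V}[\mu](x)=\frac{P_x^\perp\left(\int_{\mathcal{S}}e^{x\cdot Dy}\,Vy\,d\mu(y)\right)}{\int_{\mathcal{S}}e^{x\cdot Dy}\,d\mu(y)}$$ if and only if $d\mathcal{E}_D(\mu;W)=0$ for all Lipschitz continuous vector fields $W:\mathbb{R}^n\to\mathbb{R}^n$.
   Context: $\mathcal{S}=\{x\in\mathbb{R}^n:\|x\|=1\}$ is the Euclidean unit sphere, $\mathcal{P}(\mathcal{S})$ the set of Borel probability measures on $\mathcal{S}$, $P_x^\perp=\mathrm{Id}-xx^T$ the orthogonal projection onto the tangent space of $\mathcal{S}$ at $x\in\mathcal{S}$, and $\mathcal{E}_D(\mu)=\int_{\mathcal{S}}\int_{\mathcal{S}}e^{x\cdot Dy}\,d\mu(x)\,d\mu(y)$. The continuity equation is understood in the weak sense (tested against $C^1$ functions on $\mathcal{S}\times(0,T)$ with compact support); $\mu$ is a stationary solution if the constant curve $\mu_t\equiv\mu$ is a weak solution, i.e. $\int_{\mathcal{S}}\nabla_{\mathcal{S}}\varphi\cdot\mathsf{V}[\mu]\,d\mu=0$ for all $\varphi\in C^1(\mathcal{S})$, with $\nabla_{\mathcal{S}}$ the tangential gradient. For a Lipschitz vector field $W:\mathbb{R}^n\to\mathbb{R}^n$,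 the first variation is $d\mathcal{E}_D(\mu;W)=\frac{d}{dt}\mathcal{E}_D(\mu_t)\big|_{t=0}$, where $\mu_t$ is the (unique) weak solution of $\partial_t\mu_t+\nabla\cdot(\mu_tP_x^\perp W)=0$, $\mu_0=\mu$, i.e. $\frac{d}{dt}\int_{\mathcal{S}}\varphi\,d\mu_t=\int_{\mathcal{S}}P_x^\perp\nabla\varphi(x)\cdot W(x)\,d\mu_t(x)$ for continuously differentiable $\varphi$; this derivative exists for Lipschitz $W$. *)

(* Defs.v *)
From HB Require Import structures.
From mathcomp Require Import all_boot all_order all_algebra.
From mathcomp Require Import all_classical all_reals all_analysis.

Set Implicit Arguments.
Unset Strict Implicit.
Unset Printing Implicit Defensive.

Import Order.TTheory GRing.Theory Num.Theory.
Import numFieldNormedType.Exports.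

Local Open Scope classical_set_scope.
Local Open Scope ring_scope.

(* R^n is the type of column vectors. The library norm `|x| on 'cV[R]_n is the
   sup norm, so the Euclidean one is defined here. The two have the same
   topology and the same Lipschitz maps. *)
Definition dot (R : realType) (n : nat) (x y : 'cV[R]_n) : R :=
  \sum_(i < n) x i ord0 * y i ord0.

Definition enorm (R : realType) (n : nat) (x : 'cV[R]_n) : R :=
  Num.sqrt (dot x x).

Definition sphere (R : realType) (n : nat) : set 'cV[R]_n :=
  [set x | enorm x = 1].
Arguments sphere : clear implicits.

Definition borelE (R : realType) (n : nat) :=
  g_sigma_algebraType (@open 'cV[R]_n).

(* Borel probability measures on the (closed) unit sphere are represented by
   the Borel probability measures on R^n that give mass 1 to the sphere. *)
Definition on_sphere (R : realType) (n : nat) (mu : probability (borelE R n) R) :=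
  mu (sphere R n) = 1%E.

(* Id - x x^T, for x on the sphere. *)
Definition Pperp (R : realType) (n : nat) (x : 'cV[R]_n) : 'M[R]_n :=
  1%:M - x *m x^T.

Definition grad (R : realType) (n : nat) (phi : 'cV[R]_n -> R) (x : 'cV[R]_n) :
    'cV[R]_n :=
  \col_i 'D_(delta_mx i ord0) phi x.

(* C^1(S) is the set of restrictions to S of C^1 functions on R^n, and the
   tangential gradient of the restriction of phi is
   Pperp x *m grad phi x, whatever the extension phi. *)
Definition C1 (R : realType) (n : nat) (phi : 'cV[R]_n -> R) : Prop :=
  (forall x, differentiable phi x) /\ continuous (grad phi).

Definition sgrad (R : realType) (n : nat) (phi : 'cV[R]_n -> R) (x : 'cV[R]_n) :
    'cV[R]_n :=
  Pperp x *m grad phi x.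

Definition energy (R : realType) (n : nat) (D : 'M[R]_n)
    (mu : probability (borelE R n) R) : R :=
  (\int[mu]_(y in sphere R n)
     (\int[mu]_(x in sphere R n) expR (dot x (D *m y))))%R.

Definition velocity (R : realType) (n : nat) (D V : 'M[R]_n)
    (mu : probability (borelE R n) R) (x : 'cV[R]_n) : 'cV[R]_n :=
  (\int[mu]_(y in sphere R n) expR (dot x (D *m y)))%R^-1 *:
  (Pperp x *m
   \col_i (\int[mu]_(y in sphere R n)
             (expR (dot x (D *m y)) * (V *m y) i ord0))%R).

(* The constant curve mu is a weak solution of
   d_t mu + div (velocity D V mu * mu) = 0 on the sphere. *)
Definition stationary (R : realType) (n : nat) (D V : 'M[R]_n)
    (mu : probability (borelE R n) R) : Prop :=
  forall phi : 'cV[R]_n -> R, C1 phi ->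
    (\int[mu]_(x in sphere R n) dot (sgrad phi x) (velocity D V mu x))%R = 0.

(* Weak solution, among curves of probability measures on the sphere, of
   d_t mu_t + div (mu_t Pperp W) = 0 with mu_0 = mu. Pperp W is Lipschitz on
   the compact sphere, so its flow is complete: solutions are defined for all
   t in R and the derivative at t = 0 is two-sided. *)
Definition perturbation (R : realType) (n : nat) (W : 'cV[R]_n -> 'cV[R]_n)
    (mu : probability (borelE R n) R) (mu_ : R -> probability (borelE R n) R) :
    Prop :=
  [/\ forall t, on_sphere (mu_ t),
      forall A : set (borelE R n), measurable A -> mu_ 0 A = mu A &
      forall phi : 'cV[R]_n -> R, C1 phi -> forall t : R,
        is_derive t (1 : R)
          (fun s : R => (\int[mu_ s]_(x in sphere R n) phi x)%R)
          (\int[mu_ t]_(x in sphere R n) dot (sgrad phi x) (W x))%R].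

(* d E_D(mu; W) exists and equals d: there is a weak solution, and along it
   the energy has derivative d at t = 0 (weak solutions are unique; the
   formulation below is independent of the choice of one). *)
Definition is_first_variation (R : realType) (n : nat) (D : 'M[R]_n)
    (mu : probability (borelE R n) R) (W : 'cV[R]_n -> 'cV[R]_n) (d : R) :
    Prop :=
  (exists mu_, perturbation W mu mu_) /\
  (forall mu_, perturbation W mu mu_ ->
     is_derive (0 : R) (1 : R) (fun t : R => energy D (mu_ t)) d).

(* Main.v *)
Require Import Defs.
From HB Require Import structures.
From mathcomp Require Import all_boot all_order all_algebra.
From mathcomp Require Import all_classical all_reals all_analysis.
From mathcomp Require Import measurable_realfun ring lra.
Import Order.TTheory GRing.Theory Num.Theory.
Import numFieldNormedType.Exports.
Local Open Scope classical_set_scope.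
Local Open Scope ring_scope.

Set Implicit Arguments.
Unset Strict Implicit.
Unset Printing Implicit Defensive.

(** Write [K x y = exp (x.Dy)] and, for a probability measure [mu] on the
    sphere, [Z x] for the integral of [K x y] over [mu(dy)] ([potential]).

    The function [Z] is C1 and its gradient [B] ([potential_grad]) is the
    integral of [K x y Dy], so the velocity field is [Pperp B / Z] up to a sign,
    that is, the tangential gradient of [Z] up to a nonvanishing scalar factor.
    On the other hand [D] is symmetric, so the energy is a symmetric quadratic
    form in the measure, and its derivative along a field [W] is twice the
    integral of [Pperp B . W] ([energy_derivative]). Both sides of the
    equivalence then say the same thing, that [Pperp B] vanishes [mu]-almost
    everywhere on the sphere. If it does, the two integrals vanish. Conversely,
    testing stationarity against [Z] itself gives that the integral of
    [|Pperp B|^2 / Z] is zero, and testing the first variation against a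
    Lipschitz field equal to [B] on the sphere gives that the integral of
    [|Pperp B|^2] is zero.

    The derivative of the energy is computed for an arbitrary weak solution
    [mu_t], using nothing but the weak equation. Expanding the quadratic form
    around [mu], the linear term is a test of the equation against the fixed C1
    function [Z]. The quadratic term tests [mu_t - mu] against its own
    potential; the mean value theorem in [t], applied once to the measure and
    once to the gradient of the potential, bounds it by a multiple of [t^2]
    ([energy_remainder]).

    A weak solution exists because the field can be extended from the sphere to
    a bounded, globally Lipschitz field tangent to all centred spheres. Picard
    iteration, in a norm weighted exponentially in time, gives its flow for all
    times ([bounded_lipschitz_flow]), the flow preserves the sphere
    ([sphere_flow]), and [mu_t] is the image of [mu] under it
    ([perturbation_exists]). *)

(** * Euclidean linear algebra on column vectors *)

Section linalg.
Variables (R : realType) (n : nat).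
Implicit Types x y z u v w : 'cV[R]_n.

Lemma eq_col x y : (forall i, x i ord0 = y i ord0) -> x = y.
Proof. by move=> h; apply/matrixP => i j; rewrite ord1. Qed.

Lemma coord_le x i : `|x i ord0| <= `|x|.
Proof.
rewrite [leRHS]/Num.Def.normr/= mx_normrE.
exact: (le_bigmax _ (fun ij : 'I_n * 'I_1 => `|x ij.1 ij.2|) (i, ord0)).
Qed.

Lemma norm_le_coord x (c : R) :
  0 <= c -> (forall i, `|x i ord0| <= c) -> `|x| <= c.
Proof.
move=> c0 h; rewrite [leLHS]/Num.Def.normr/= mx_normrE.
by apply: bigmax_le => // -[i j] _ /=; rewrite ord1.
Qed.

Lemma dotC x y : dot x y = dot y x.
Proof. by apply: eq_bigr => i _; rewrite mulrC. Qed.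

Lemma dotDl x y z : dot (x + y) z = dot x z + dot y z.
Proof. by rewrite -big_split; apply: eq_bigr => i _; rewrite mxE mulrDl. Qed.

Lemma dotZl (a : R) x y : dot (a *: x) y = a * dot x y.
Proof. by rewrite mulr_sumr; apply: eq_bigr => i _; rewrite mxE mulrA. Qed.

Lemma dotDr x y z : dot x (y + z) = dot x y + dot x z.
Proof. by rewrite dotC dotDl !(dotC _ x). Qed.

Lemma dotZr (a : R) x y : dot x (a *: y) = a * dot x y.
Proof. by rewrite dotC dotZl dotC. Qed.

Lemma dotNl x y : dot (- x) y = - dot x y.
Proof. by rewrite -scaleN1r dotZl mulN1r. Qed.

Lemma dotNr x y : dot x (- y) = - dot x y.
Proof. by rewrite dotC dotNl dotC. Qed.

Lemma dotBl x y z : dot (x - y) z = dot x z - dot y z.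
Proof. by rewrite dotDl dotNl. Qed.

Lemma dotBr x y z : dot x (y - z) = dot x y - dot x z.
Proof. by rewrite dotDr dotNr. Qed.

Lemma dot_tr x y : x^T *m y = (dot x y)%:M.
Proof.
apply/matrixP => i j; rewrite !mxE !ord1 eqxx mulr1n.
by apply: eq_bigr => k _; rewrite mxE.
Qed.

Lemma dot_mulmxl (A : 'M[R]_n) x y : dot x (A *m y) = dot (A^T *m x) y.
Proof.
have h : forall a b : R, (a%:M : 'M[R]_1) = b%:M -> a = b.
  by move=> a b /matrixP/(_ ord0 ord0); rewrite !mxE eqxx !mulr1n.
by apply: h; rewrite -!dot_tr trmx_mul trmxK mulmxA.
Qed.

Lemma dotxx_ge0 x : 0 <= dot x x.
Proof. by apply: sumr_ge0 => i _; rewrite -expr2 sqr_ge0. Qed.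

Lemma dotxx_eq0 x : dot x x = 0 -> x = 0.
Proof.
move=> h; apply: eq_col => i; rewrite mxE.
have := h => /eqP; rewrite psumr_eq0; last by move=> j _; rewrite -expr2 sqr_ge0.
by move=> /allP/(_ i (mem_index_enum _)); rewrite -expr2 sqrf_eq0 => /eqP.
Qed.

Lemma dot_norm_le x y : `|dot x y| <= n%:R * (`|x| * `|y|).
Proof.
apply: le_trans (ler_norm_sum _ _ _) _.
rewrite (le_trans (ler_sum _ (G := fun=> `|x| * `|y|) _))//.
  by move=> i _; rewrite normrM ler_pM// coord_le.
by rewrite sumr_const card_ord mulr_natl.
Qed.

Lemma mulmx_norm_le (A : 'M[R]_n) x : `|A *m x| <= n%:R * (`|A| * `|x|).
Proof.
apply: norm_le_coord => [|i]; first by rewrite !mulr_ge0.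
rewrite mxE; apply: le_trans (ler_norm_sum _ _ _) _.
rewrite (le_trans (ler_sum _ (G := fun=> `|A| * `|x|) _))//.
  move=> j _; rewrite normrM ler_pM// ?coord_le//.
  rewrite [leRHS]/Num.Def.normr/= mx_normrE.
  exact: (le_bigmax _ (fun ij : 'I_n * 'I_n => `|A ij.1 ij.2|) (i, j)).
by rewrite sumr_const card_ord mulr_natl.
Qed.

Lemma PperpE x v : Pperp x *m v = v - dot x v *: x.
Proof.
rewrite /Pperp mulmxBl mul1mx -mulmxA dot_tr.
by rewrite mul_mx_scalar.
Qed.

Lemma dot_Pperp x v w : dot (Pperp x *m v) w = dot v w - dot x v * dot x w.
Proof. by rewrite PperpE dotBl dotZl. Qed.

Lemma sphere_dot x : sphere R n x <-> dot x x = 1.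
Proof.
rewrite /sphere/= /enorm; split=> [h|->]; last by rewrite sqrtr1.
by rewrite -(sqr_sqrtr (dotxx_ge0 x)) h expr1n.
Qed.

Lemma sphere_norm_le1 x : sphere R n x -> `|x| <= 1.
Proof.
move=> /sphere_dot h; apply: norm_le_coord => // i.
rewrite -(@ler_pXn2r _ 2)// ?nnegrE// expr1n real_normK ?num_real//.
rewrite -h /dot (bigD1 i)//= -expr2 lerDl.
by apply: sumr_ge0 => j _; rewrite -expr2 sqr_ge0.
Qed.

(** [Pperp x] is an orthogonal projection when [x] is on the sphere. *)
Lemma dot_Pperp_idem x v : sphere R n x ->
  dot (Pperp x *m v) v = dot (Pperp x *m v) (Pperp x *m v).
Proof.
by move=> /sphere_dot h; rewrite !PperpE !dotBr !dotBl !dotZl !dotZr h dotC; ring.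
Qed.

End linalg.

(** * Continuity, Lipschitz bounds on balls and C1 functions *)

Lemma near_dist_le (R : realType) (V : normedModType R) (x : V) (e : R) :
  0 < e -> \forall y \near x, `|x - y| <= e.
Proof. by move=> e0; have /cvgrPdist_le := @cvg_id _ (nbhs x); apply. Qed.

Section continuity.
Variables (R : realType) (n : nat) (T : topologicalType).

Lemma continuous_col (f : 'I_n -> T -> R) :
  (forall i, continuous (f i)) -> continuous (fun x => \col_i f i x).
Proof.
move=> cf x; apply/cvgrPdist_le => /= e e0.
near=> y; apply: norm_le_coord => [|i]; first exact: ltW.
rewrite !mxE; move: i; near: y; apply: filter_forall => i.
by have /cvgrPdist_le := cf i x; apply.
Unshelve. all: end_near. Qed.

Lemma continuous_coord (f : T -> 'cV[R]_n) i :
  continuous f -> continuous (fun x => f x i ord0).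
Proof.
move=> cf x; apply: (@continuous_comp _ _ _ f (fun v : 'cV[R]_n => v i ord0)).
  exact: cf.
exact: coord_continuous.
Qed.

Lemma continuous_mul (f g : T -> R) :
  continuous f -> continuous g -> continuous (fun x => f x * g x).
Proof. by move=> cf cg x; apply: continuousM; [exact: cf|exact: cg]. Qed.

Lemma continuous_sub (f g : T -> R) :
  continuous f -> continuous g -> continuous (fun x => f x - g x).
Proof. by move=> cf cg x; apply: continuousB; [exact: cf|exact: cg]. Qed.

Lemma continuous_expR_comp (f : T -> R) :
  continuous f -> continuous (fun x => expR (f x)).
Proof.
move=> cf x; apply: (@continuous_comp _ _ _ f (@expR R)); first exact: cf.
exact: continuous_expR.
Qed.

Lemma continuous_dot (f g : T -> 'cV[R]_n) :
  continuous f -> continuous g -> continuous (fun x => dot (f x) (g x)).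
Proof.
move=> cf cg; apply: continuous_big => [|i _ x]; first exact: add_continuous.
by apply: continuousM; exact: continuous_coord.
Qed.

End continuity.

Section on_balls.
Variables (R : realType) (n : nat).
Local Notation vec := 'cV[R]_n.

Lemma continuous_bounded_ball (f : vec -> R) (r : R) : continuous f ->
  exists2 C, 0 <= C & forall x, `|x| <= r -> `|f x| <= C.
Proof.
(* Boundedness is transported from row vectors, whose closed balls are compact,
   by transposition. *)
move=> cf; pose g (v : 'rV[R]_n) := f (v^T).
have tr_norm (v : 'rV[R]_n) : `|v^T| <= `|v|.
  apply: norm_le_coord => // i; rewrite mxE [leRHS]/Num.Def.normr/= mx_normrE.
  exact: (le_bigmax _ (fun ij : 'I_1 * 'I_n => `|v ij.1 ij.2|) (ord0, i)).
have tr_norm' (x : vec) : `|x^T| <= `|x|.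
  rewrite [leLHS]/Num.Def.normr/= mx_normrE.
  by apply: bigmax_le => // -[i j] _ /=; rewrite ord1 mxE coord_le.
have cg : continuous g.
  move=> v; apply: (@continuous_comp _ _ _ (fun v : 'rV[R]_n => v^T) f); last exact: cf.
  apply/(@cvgrPdist_le _ _ _ (nbhs v)) => /= e e0.
  apply: filterS (near_dist_le v e0) => w vw.
  by rewrite -linearB/= (le_trans (tr_norm _)).
have cpt : compact [set v : 'rV[R]_n | `|v| <= r].
  apply: bounded_closed_compact.
    exists r; split; first exact: num_real.
    by move=> M rM v /= /le_trans; apply; exact: ltW.
  apply: (@closed_comp _ _ (fun v : 'rV[R]_n => `|v|) [set y | y <= r]).
    by move=> v _; exact: norm_continuous.
  exact: closed_le.
have [M [Mr hM]] := compact_bounded (continuous_compact (continuous_subspaceT cg) cpt).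
exists (`|M| + 1) => [|x xr]; first by rewrite addr_ge0.
apply: hM; first by rewrite (le_lt_trans (ler_norm _))// ltrDl.
by exists (x^T) => /=; rewrite ?/g ?trmxK// (le_trans (tr_norm' _)).
Qed.

(** Bounding the values together with the increments makes this class of maps
    closed under products, unlike the class of Lipschitz maps. *)
Definition lip_ball (V : normedModType R) (r : R) (f : vec -> V) :=
  exists2 C, 0 <= C & forall x y, `|x| <= r -> `|y| <= r ->
    `|f x| <= C /\ `|f x - f y| <= C * `|x - y|.

Variable r : R.

Lemma lip_ball_id : lip_ball r (fun x : vec => x).
Proof.
exists (`|r| + 1) => [|x y xr yr]; first by rewrite addr_ge0.
split; first by rewrite (le_trans xr)// (le_trans (ler_norm _))// lerDl.
by rewrite ler_peMl// lerDr.
Qed.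

Lemma lip_ballD (V : normedModType R) (f g : vec -> V) :
  lip_ball r f -> lip_ball r g -> lip_ball r (fun x => f x + g x).
Proof.
move=> [C C0 hf] [D D0 hg]; exists (C + D) => [|x y xr yr]; first exact: addr_ge0.
have [f1 f2] := hf x y xr yr; have [g1 g2] := hg x y xr yr.
split; first by rewrite (le_trans (ler_normD _ _))// lerD.
by rewrite opprD addrACA (le_trans (ler_normD _ _))// mulrDl lerD.
Qed.

Lemma lip_ballZ (V : normedModType R) (k : vec -> R) (f : vec -> V) :
  lip_ball r k -> lip_ball r f -> lip_ball r (fun x => k x *: f x).
Proof.
move=> [C C0 hf] [D D0 hg]; exists (C * D * 2) => [|x y xr yr].
  by rewrite !mulr_ge0.
have [k1 k2] := hf x y xr yr; have [g1 g2] := hg x y xr yr.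
have [k1' _] := hf y x yr xr.
split.
  rewrite normrZ (le_trans (ler_pM _ _ k1 g1))// ler_peMr ?mulr_ge0//.
  by rewrite ler1n.
have -> : k x *: f x - k y *: f y = (k x - k y) *: f x + k y *: (f x - f y).
  by rewrite scalerBl scalerBr addrA subrK.
rewrite (le_trans (ler_normD _ _))// !normrZ.
have -> : C * D * 2 * `|x - y| = C * `|x - y| * D + C * (D * `|x - y|) by ring.
by apply: lerD; rewrite ler_pM.
Qed.

Lemma lip_ball_sum (I : Type) (s : seq I) (V : normedModType R) (f : I -> vec -> V) :
  (forall i, lip_ball r (f i)) -> lip_ball r (fun x => \sum_(i <- s) f i x).
Proof.
move=> hf; elim: s => [|i s ih].
  by exists 0 => // x y _ _; rewrite !big_nil subr0 normr0 mul0r.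
have -> : (fun x => \sum_(j <- i :: s) f j x) =
          (fun x => f i x + \sum_(j <- s) f j x).
  by apply/funext => x; rewrite big_cons.
exact: lip_ballD.
Qed.

Lemma lip_ball_coord (f : vec -> vec) i :
  lip_ball r f -> lip_ball r (fun x => f x i ord0).
Proof.
move=> [C C0 hf]; exists C => // x y xr yr; have [f1 f2] := hf x y xr yr.
split; first exact: le_trans (coord_le _ _) f1.
by apply: le_trans f2; have := coord_le (f x - f y) i; rewrite !mxE.
Qed.

Lemma lip_ball_dot (f g : vec -> vec) :
  lip_ball r f -> lip_ball r g -> lip_ball r (fun x => dot (f x) (g x)).
Proof.
move=> hf hg; apply: lip_ball_sum => i.
by apply: (@lip_ballZ R^o); exact: lip_ball_coord.
Qed.

Lemma lip_ball_lipschitz (f : vec -> vec) :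
  [lipschitz f x | x in [set: vec]] -> lip_ball r f.
Proof.
move=> lf0; have pf : ProperFilter (globally ([set: vec] `*` [set: vec])).
  exact: (@globally_properfilter _ _ (0, 0)).
have [M hM] := (ex_dom_bound _ _).1 lf0; pose L := `|M|.
have L0 : 0 <= L by exact: normr_ge0.
have lf x y : `|f x - f y| <= L * `|x - y|.
  have /= := hM (x, y) (conj I I); rewrite /self_sub => /le_trans; apply.
  by rewrite ler_wpM2r// ler_norm.
exists (`|f 0| + L * (`|r| + 1)) => [|x y xr yr].
  by rewrite addr_ge0// mulr_ge0// addr_ge0.
split.
  rewrite -[f x](subrK (f 0)) addrC (le_trans (ler_normD _ _))// lerD2l.
  rewrite (le_trans (lf _ _))// subr0 ler_wpM2l ?normr_ge0// (le_trans xr)//.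
  by rewrite (le_trans (ler_norm _))// lerDl.
rewrite (le_trans (lf _ _))// ler_wpM2r// ler_wpDl// ler_peMr ?normr_ge0//.
by rewrite lerDr.
Qed.

End on_balls.

Section differentiability.
Variables (R : realType) (n : nat).
Local Notation vec := 'cV[R]_n.

Lemma lip_ball_continuous (V : normedModType R) (f : vec -> V) :
  (forall r, lip_ball r f) -> continuous f.
Proof.
move=> hf x; have [C C0 hC] := hf (`|x| + 1).
apply/(@cvgrPdist_le _ _ _ (nbhs x)) => /= e e0.
have d0 : 0 < Num.min 1 (e / (C + 1)) by rewrite lt_min ltr01 divr_gt0// ltr_wpDl.
apply: filterS (near_dist_le x d0) => y xy.
have [||_] := hC x y.
- by rewrite lerDl.
- have -> : y = x - (x - y) by rewrite opprB addrC subrK.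
  rewrite (le_trans (ler_normB _ _))// lerD2l (le_trans xy)//.
  by rewrite ge_min lexx.
move=> /le_trans; apply.
have : `|x - y| <= e / (C + 1) by rewrite (le_trans xy)// ge_min lexx orbT.
rewrite ler_pdivlMr ?ltr_wpDl// => /(le_trans _); apply.
by rewrite mulrC ler_wpM2l// lerDl.
Qed.

(** A second-order error bound is a convenient sufficient condition for
    Fréchet differentiability: it survives integration in a parameter. *)
Lemma differentiable_quadratic (f : vec -> R) x b (C : R) :
  (forall h, `|h| <= 1 -> `|f (h + x) - f x - dot b h| <= C * `|h| ^+ 2) ->
  differentiable f x /\ forall v, 'D_v f x = dot b v.
Proof.
move=> hf.
have dl : linear (dot b : vec -> R) by move=> a u v; rewrite dotDr dotZr.
pose dM := GRing.isLinear.Build _ _ _ _ _ dl.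
pose d : {linear vec -> R} := HB.pack (dot b : vec -> R) dM.
have dc : continuous (d : vec -> R).
  apply: continuous_dot; [exact: cst_continuous|by move=> y].
have fd : f \o shift x = cst (f x) + d +o_ (0 : vec) id.
  apply/eqaddoP => e e0.
  have d0 : 0 < Num.min 1 (e / (`|C| + 1)).
    by rewrite lt_min ltr01 divr_gt0// ltr_wpDl.
  apply: filterS (near_dist_le (0 : vec) d0) => h; rewrite sub0r normrN => h1.
  rewrite /= !fctE opprD addrA (le_trans (hf _ _))//.
    by rewrite (le_trans h1)// ge_min lexx.
  rewrite expr2 mulrA ler_wpM2r//.
  have : `|h| <= e / (`|C| + 1) by rewrite (le_trans h1)// ge_min lexx orbT.
  rewrite ler_pdivlMr ?ltr_wpDl// => /(le_trans _); apply.
  by rewrite mulrC ler_wpM2l// ler_wpDr// ler_norm.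
have dE := diff_unique dc fd.
have df : differentiable f x.
  by apply/diff_locallyP; rewrite dE; split.
by split=> // v; rewrite deriveE// dE.
Qed.

Lemma differentiable_dot (z x : vec) :
  differentiable (dot z) x /\ forall v, 'D_v (dot z) x = dot z v.
Proof.
apply: (@differentiable_quadratic _ _ _ 0) => h _.
by rewrite dotDr addrK subrr normr0 mul0r.
Qed.

(** Differentiability is what makes the gradient, a vector of partial
    derivatives, compute all directional derivatives. *)
Lemma derive_grad (f : vec -> R) x v :
  differentiable f x -> 'D_v f x = dot (grad f x) v.
Proof.
move=> df; rewrite deriveE//.
have {1}-> : v = \sum_i v i ord0 *: delta_mx i ord0.
  by rewrite {1}(matrix_sum_delta v); apply: eq_bigr => i _; rewrite big_ord1.
rewrite linear_sum; apply: eq_bigr => i _.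
by rewrite linearZ /= mxE deriveE// mulrC.
Qed.

Lemma C1_of_grad (f : vec -> R) (g : vec -> vec) :
  (forall x, differentiable f x /\ forall v, 'D_v f x = dot (g x) v) ->
  continuous g -> C1 f /\ grad f = g.
Proof.
move=> hf cg; have gE : grad f = g.
  apply/funext => x; apply: eq_col => i; rewrite mxE (hf x).2.
  rewrite /dot (bigD1 i)//= big1 ?addr0 ?mxE ?eqxx ?mulr1// => j ji.
  by rewrite mxE (negbTE ji) mulr0.
by split=> //; split=> [x|]; [exact: (hf x).1|rewrite gE].
Qed.

Lemma C1_continuous (f : vec -> R) : C1 f -> continuous f.
Proof. by move=> [df _] x; exact: differentiable_continuous. Qed.

End differentiability.

(** * Integration over the sphere *)

Section borel.
Variables (R : realType) (n : nat).
Local Notation vec := 'cV[R]_n.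
Local Notation S := (sphere R n).

Lemma continuous_measurable_borelE (f : vec -> R) (A : set (borelE R n)) :
  continuous f -> measurable_fun A (f : borelE R n -> R).
Proof.
move=> /continuousP cf; apply: (@measurable_funS _ _ _ _ setT) => //.
apply: (measurability _ (measurable_realfun.RGenOpens.measurableE R)).
move=> _ [_ [a [b ->]] <-].
rewrite setTI; apply: sub_sigma_algebra; apply: cf; exact: interval_open.
Qed.

Lemma continuous_measurable_borelE_map (f : vec -> vec) :
  continuous f -> measurable_fun setT (f : borelE R n -> borelE R n).
Proof.
move=> /continuousP cf.
apply: (@measurability _ _ (borelE R n) (borelE R n) setT f (@open vec)) => //.
move=> _ [U oU <-]; rewrite setTI; apply: sub_sigma_algebra; exact: cf.
Qed.

(** The sphere is the preimage of [1] under the continuous map [x |-> x.x]. *)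
Lemma sphere_measurable : measurable (S : set (borelE R n)).
Proof.
have -> : (S : set (borelE R n)) =
    (fun x : borelE R n => dot (x : vec) x) @^-1` [set 1].
  by apply/seteqP; split => x /sphere_dot.
rewrite -[X in measurable X]setTI.
have mf := @continuous_measurable_borelE (fun x => dot x x) setT
  (continuous_dot (fun=> cvg_id) (fun=> cvg_id)).
exact: mf.
Qed.

Variable nu : probability (borelE R n) R.

Lemma ae_imply (P Q : vec -> Prop) : (forall x, P x -> Q x) ->
  {ae nu, forall x, P x} -> {ae nu, forall x, Q x}.
Proof.
move=> PQ; apply: (@filterS _ _ (ae_filter_ringOfSetsType nu)) => x.
exact: PQ.
Qed.

Lemma continuous_bounded_sphere (f : vec -> R) : continuous f ->
  exists2 C, 0 <= C & forall x, S x -> `|f x| <= C.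
Proof.
move=> cf; have [C C0 hC] := continuous_bounded_ball 1 cf.
by exists C => // x /sphere_norm_le1; exact: hC.
Qed.

(** A continuous function is bounded on the sphere, which has finite mass. *)
Lemma continuous_integrable (f : vec -> R) : continuous f ->
  nu.-integrable S (EFin \o (f : borelE R n -> R)).
Proof.
move=> cf; have [C C0 hC] := continuous_bounded_sphere cf.
apply: measurable_bounded_integrable.
- exact: sphere_measurable.
- by rewrite (le_lt_trans (probability_le1 _ sphere_measurable))// ltry.
- exact: continuous_measurable_borelE.
- exists C; split; first exact: num_real.
  by move=> M CM x Sx; apply: le_trans (hC _ Sx) _; exact: ltW.
Qed.

Hypothesis nuS : on_sphere nu.

Lemma Rintegral_sphere_cst (c : R) : (\int[nu]_(x in S) c)%R = c.
Proof.
rewrite Rintegral_cst; last exact: sphere_measurable.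
by rewrite -[RHS]mulr1; congr (_ * _); exact: (congr1 fine nuS).
Qed.

Lemma Rintegral_sphere_le (f : vec -> R) C : continuous f ->
  (forall x, S x -> `|f x| <= C) -> `|(\int[nu]_(x in S) f x)%R| <= C.
Proof.
move=> cf hf.
apply: le_trans (le_normr_Rintegral sphere_measurable (continuous_integrable cf)) _.
rewrite -[leRHS]Rintegral_sphere_cst; apply: le_Rintegral => //.
- exact: sphere_measurable.
- apply: (@continuous_integrable (fun x => `|f x|)) => x.
  apply: (@continuous_comp _ _ _ f (@Num.norm _ R)); first exact: cf.
  exact: norm_continuous.
- by apply: (@continuous_integrable (fun=> C)) => x; exact: cst_continuous.
Qed.

Lemma Rintegral_sphereB (f g : vec -> R) : continuous f -> continuous g ->
  (\int[nu]_(x in S) (f x - g x))%R =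
  (\int[nu]_(x in S) f x)%R - (\int[nu]_(x in S) g x)%R.
Proof.
move=> cf cg; apply: RintegralB; first exact: sphere_measurable.
  exact: continuous_integrable.
exact: continuous_integrable.
Qed.

Lemma Rintegral_sphereZ (a : R) (f : vec -> R) : continuous f ->
  (\int[nu]_(x in S) (a * f x))%R = a * (\int[nu]_(x in S) f x)%R.
Proof.
move=> cf; apply: RintegralZl; first exact: sphere_measurable.
exact: continuous_integrable.
Qed.

Lemma Rintegral_sphere_sum (I : Type) (s : seq I) (f : I -> vec -> R) :
  (forall i, continuous (f i)) ->
  (\int[nu]_(x in S) (\sum_(i <- s) f i x))%R =
  \sum_(i <- s) (\int[nu]_(x in S) f i x)%R.
Proof.
move=> cf; elim: s => [|i s ih].
  under eq_Rintegral do rewrite big_nil.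
  by rewrite big_nil Rintegral_sphere_cst.
under eq_Rintegral do rewrite big_cons.
rewrite big_cons -ih; apply: RintegralD; first exact: sphere_measurable.
  exact: continuous_integrable.
apply: (@continuous_integrable (fun x => \sum_(j <- s) f j x)).
by apply: continuous_big => //; exact: add_continuous.
Qed.

Lemma Rintegral_sphere_eq0 (f : vec -> R) : continuous f ->
  (forall x, S x -> 0 <= f x) -> (\int[nu]_(x in S) f x)%R = 0 ->
  {ae nu, forall x, S x -> f x = 0}.
Proof.
move=> cf f0 intf0.
have mf := measurable_int nu (continuous_integrable cf).
have [+ _] := ae_eq_integral_abs nu sphere_measurable mf.
have hint : (\int[nu]_(x in S) `|(EFin \o (f : borelE R n -> R)) x| = 0)%E.
  transitivity (\int[nu]_(x in S) (f x)%:E)%E.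
    by apply: eq_integral => x /set_mem Sx /=; rewrite ger0_norm// f0.
  rewrite -[LHS]fineK; first by move: intf0; rewrite /Rintegral => ->.
  by apply: integrable_fin_num; [exact: sphere_measurable|exact: continuous_integrable].
move=> /(_ hint); by apply: filterS => x h Sx; have [] := h Sx.
Qed.

Lemma Rintegral_sphere_ae (f g : vec -> R) : continuous f -> continuous g ->
  {ae nu, forall x, S x -> f x = g x} ->
  (\int[nu]_(x in S) f x)%R = (\int[nu]_(x in S) g x)%R.
Proof.
move=> cf cg fg; congr fine; apply: ae_eq_integral.
- exact: sphere_measurable.
- exact: measurable_int (continuous_integrable _).
- exact: measurable_int (continuous_integrable _).
- apply: ae_imply fg => x h Sx /=; by rewrite h.
Qed.

End borel.

(** * The potential and its gradient *)

Section exponential.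
Variable R : realType.
Implicit Types u v M : R.

(** Both estimates come from the tangent line inequality [1 + u <= exp u],
    applied to [u - v] and to [v - u]. *)
Lemma expR_lipschitz M u v : `|u| <= M -> `|v| <= M ->
  `|expR u - expR v| <= expR M * `|u - v|.
Proof.
have h a b : `|a| <= M -> b <= a -> expR a - expR b <= expR M * (a - b).
  move=> aM ba; have := expR_ge1Dx (b - a); rewrite -(ler_pM2l (expR_gt0 a)).
  rewrite -expRD [a + (b - a)]addrC subrK => h.
  apply: (@le_trans _ _ (expR a * (a - b))); first by move: h; lra.
  by rewrite ler_wpM2r ?subr_ge0// ler_expR (le_trans (ler_norm _)).
move=> uM vM; have [uv|/ltW uv] := leP u v.
  by rewrite distrC (distrC u) !ger0_norm ?subr_ge0 ?ler_expR// h.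
by rewrite !ger0_norm ?subr_ge0 ?ler_expR// h.
Qed.

Lemma expR_taylor1 M u v : `|u| <= M -> `|v| <= M ->
  `|expR u - expR v - expR v * (u - v)| <= expR M * `|u - v| ^+ 2.
Proof.
move=> uM vM.
have h1 := expR_ge1Dx (u - v); have h2 := expR_ge1Dx (v - u).
move: h1; rewrite -(ler_pM2l (expR_gt0 v)) -expRD [v + (u - v)]addrC subrK => h1.
move: h2; rewrite -(ler_pM2l (expR_gt0 u)) -expRD [u + (v - u)]addrC subrK => h2.
rewrite ger0_norm; last by move: h1; lra.
apply: (@le_trans _ _ ((expR u - expR v) * (u - v))); first by move: h2; lra.
rewrite (le_trans (ler_norm _))// normrM expr2 mulrA ler_wpM2r//.
exact: expR_lipschitz.
Qed.

End exponential.

Section kernel.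
Variables (R : realType) (n : nat) (D : 'M[R]_n).
Local Notation vec := 'cV[R]_n.
Local Notation S := (sphere R n).

Lemma continuous_mulmx (A : 'M[R]_n) : continuous (fun y : vec => A *m y).
Proof.
apply: lip_ball_continuous => r.
exists (n%:R * `|A| * (`|r| + 1)) => [|x y xr yr].
  by rewrite !mulr_ge0// addr_ge0.
split.
  rewrite (le_trans (mulmx_norm_le _ _))// -mulrA ler_wpM2l// ler_wpM2l//.
  by rewrite (le_trans xr)// (le_trans (ler_norm _))// lerDl.
rewrite -mulmxBr (le_trans (mulmx_norm_le _ _))// mulrA ler_wpM2r//.
by rewrite ler_peMr ?mulr_ge0// lerDr.
Qed.

Lemma continuous_expR_dot (x : vec) : continuous (fun y : vec => expR (dot x (D *m y))).
Proof.
apply: continuous_expR_comp.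
apply: continuous_dot; [exact: cst_continuous|exact: continuous_mulmx].
Qed.

Lemma continuous_kernel_coord (x : vec) i :
  continuous (fun y : vec => expR (dot x (D *m y)) * (D *m y) i ord0).
Proof.
apply: continuous_mul; first exact: continuous_expR_dot.
by apply: continuous_coord; exact: continuous_mulmx.
Qed.

(* The constant in [|x.Dy| <= c |x|], uniform in [y] on the sphere. *)
Let c : R := n%:R * (n%:R * `|D|).

Let c_ge0 : 0 <= c. Proof. by rewrite !mulr_ge0. Qed.

Lemma dot_mulmx_sphere_le x y : S y -> `|dot x (D *m y)| <= c * `|x|.
Proof.
move=> /sphere_norm_le1 y1; rewrite (le_trans (dot_norm_le _ _))// /c -[leRHS]mulrA.
rewrite ler_wpM2l// mulrC ler_wpM2r//.
by rewrite (le_trans (mulmx_norm_le _ _))// ler_wpM2l// ler_piMr.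
Qed.

Lemma mulmx_sphere_le y : S y -> `|D *m y| <= n%:R * `|D|.
Proof.
move=> /sphere_norm_le1 y1.
by rewrite (le_trans (mulmx_norm_le _ _))// ler_wpM2l// ler_piMr.
Qed.

Lemma kernel_le r x y : S y -> `|x| <= r -> `|expR (dot x (D *m y))| <= expR (c * r).
Proof.
move=> Sy xr; rewrite ger0_norm ?expR_ge0// ler_expR (le_trans (ler_norm _))//.
by rewrite (le_trans (dot_mulmx_sphere_le _ Sy))// ler_wpM2l.
Qed.

(** The potential is both the denominator of the velocity field and, once
    integrated against [nu] itself, the energy of [nu]. *)
Definition potential (nu : probability (borelE R n) R) (x : vec) : R :=
  (\int[nu]_(y in S) expR (dot x (D *m y)))%R.

Definition potential_grad (nu : probability (borelE R n) R) (x : vec) : vec :=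
  \col_i (\int[nu]_(y in S) (expR (dot x (D *m y)) * (D *m y) i ord0))%R.

Variable nu : probability (borelE R n) R.
Hypothesis nuS : on_sphere nu.

Lemma dot_potential_grad x w :
  dot (potential_grad nu x) w =
  (\int[nu]_(y in S) (expR (dot x (D *m y)) * dot (D *m y) w))%R.
Proof.
under eq_Rintegral do rewrite /dot mulr_sumr.
rewrite Rintegral_sphere_sum//; last first.
  move=> i; under eq_fun do rewrite mulrA.
  by apply: continuous_mul; [exact: continuous_kernel_coord|exact: cst_continuous].
apply: eq_bigr => i _; rewrite mxE.
under [RHS]eq_Rintegral do rewrite mulrA mulrC.
by rewrite Rintegral_sphereZ ?(mulrC (w i ord0))//; exact: continuous_kernel_coord.
Qed.

(** The second-order Taylor bound of the exponential is uniform in [y] on the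
    sphere, so it can be integrated in [y]. *)
Lemma potential_differentiable x :
  differentiable (potential nu) x /\
  forall v, 'D_v (potential nu) x = dot (potential_grad nu x) v.
Proof.
pose M := c * (`|x| + 1).
apply: (@differentiable_quadratic _ _ _ _ _ (expR M * c ^+ 2)) => h h1.
rewrite dot_potential_grad /potential -!Rintegral_sphereB; first last.
- exact: continuous_expR_dot.
- exact: continuous_expR_dot.
- apply: continuous_mul; first exact: continuous_expR_dot.
  by apply: continuous_dot; [exact: continuous_mulmx|exact: cst_continuous].
- by apply: continuous_sub; exact: continuous_expR_dot.
apply: Rintegral_sphere_le => //.
  apply: continuous_sub.
    by apply: continuous_sub; exact: continuous_expR_dot.
  apply: continuous_mul; first exact: continuous_expR_dot.
  by apply: continuous_dot; [exact: continuous_mulmx|exact: cst_continuous].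
move=> y Sy.
have -> : dot (D *m y) h = dot (h + x) (D *m y) - dot x (D *m y).
  by rewrite dotDl addrK dotC.
apply: le_trans (expR_taylor1 (M := M) _ _) _.
- rewrite (le_trans (dot_mulmx_sphere_le _ Sy))// ler_wpM2l//.
  by rewrite (le_trans (ler_normD _ _))// addrC lerD2l.
- by rewrite (le_trans (dot_mulmx_sphere_le _ Sy))// ler_wpM2l// lerDl.
rewrite dotDl addrK -mulrA ler_wpM2l ?expR_ge0// -exprMn.
by rewrite lerXn2r ?nnegrE ?mulr_ge0// dot_mulmx_sphere_le.
Qed.

Lemma potential_grad_lip r : lip_ball r (potential_grad nu).
Proof.
have d0 : 0 <= n%:R * `|D| by rewrite mulr_ge0.
exists (expR (c * r) * (1 + c) * (n%:R * `|D|)) => [|x y xr yr].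
  by rewrite !mulr_ge0 ?expR_ge0// addr_ge0.
have cle i z : S z -> `|(D *m z) i ord0| <= n%:R * `|D|.
  by move=> Sz; rewrite (le_trans (coord_le _ _))// mulmx_sphere_le.
split; (apply: norm_le_coord => [|i]; first by rewrite !mulr_ge0 ?expR_ge0// addr_ge0).
  rewrite mxE; apply: Rintegral_sphere_le => //.
    exact: continuous_kernel_coord.
  move=> z Sz; rewrite normrM ler_pM ?cle//.
  rewrite (le_trans (kernel_le Sz xr))// ler_peMr ?expR_ge0//.
  by rewrite lerDl.
rewrite !mxE -Rintegral_sphereB; [|exact: continuous_kernel_coord..].
apply: Rintegral_sphere_le => //.
  by apply: continuous_sub; exact: continuous_kernel_coord.
move=> z Sz; rewrite -mulrBl normrM.
apply: (@le_trans _ _ (expR (c * r) * (c * `|x - y|) * (n%:R * `|D|))).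
  rewrite ler_pM ?cle//.
  apply: le_trans (expR_lipschitz (M := c * r) _ _) _.
  - by rewrite (le_trans (dot_mulmx_sphere_le _ Sz))// ler_wpM2l.
  - by rewrite (le_trans (dot_mulmx_sphere_le _ Sz))// ler_wpM2l.
  by rewrite -dotBl ler_wpM2l ?expR_ge0// dot_mulmx_sphere_le.
have -> : expR (c * r) * (1 + c) * (n%:R * `|D|) * `|x - y| =
  expR (c * r) * ((1 + c) * `|x - y|) * (n%:R * `|D|) by ring.
by rewrite ler_wpM2r// ler_wpM2l ?expR_ge0// ler_wpM2r// lerDr.
Qed.

Lemma potential_grad_continuous : continuous (potential_grad nu).
Proof. exact: lip_ball_continuous potential_grad_lip. Qed.

Lemma potential_C1 :
  C1 (potential nu) /\ grad (potential nu) = potential_grad nu.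
Proof. exact: C1_of_grad potential_differentiable potential_grad_continuous. Qed.

Lemma potential_gt0 x : 0 < potential nu x.
Proof.
apply: (@lt_le_trans _ _ (expR (- (c * `|x|)))); first exact: expR_gt0.
rewrite -[leLHS](Rintegral_sphere_cst nuS); apply: le_Rintegral.
- exact: sphere_measurable.
- apply: (@continuous_integrable _ _ _ (fun=> expR (- (c * `|x|)))) => y.
  exact: cst_continuous.
- by apply: continuous_integrable; exact: continuous_expR_dot.
move=> y Sy; rewrite ler_expR.
by have := dot_mulmx_sphere_le x Sy; rewrite ler_norml => /andP[].
Qed.

End kernel.

Section exponential_test_function.
Variables (R : realType) (n : nat).
Local Notation vec := 'cV[R]_n.

Lemma differentiable_expR_dot (z x : vec) :
  differentiable (fun x => expR (dot z x)) x /\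
  forall v, 'D_v (fun x => expR (dot z x)) x = expR (dot z x) * dot z v.
Proof.
pose M := n%:R * (`|z| * (`|x| + 1)).
have [|h1 h2] := @differentiable_quadratic R n (fun x => expR (dot z x)) x
    (expR (dot z x) *: z) (expR M * (n%:R * `|z|) ^+ 2); last first.
  by split=> // v; rewrite h2 dotZl.
move=> h h1; rewrite dotZl.
have -> : dot z h = dot z (h + x) - dot z x by rewrite dotDr addrK.
apply: le_trans (expR_taylor1 (M := M) _ _) _.
- rewrite (le_trans (dot_norm_le _ _))// ler_wpM2l// ler_wpM2l//.
  by rewrite (le_trans (ler_normD _ _))// addrC lerD2l.
- by rewrite (le_trans (dot_norm_le _ _))// ler_wpM2l// ler_wpM2l// lerDl.
rewrite dotDr addrK -mulrA ler_wpM2l ?expR_ge0// -exprMn.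
by rewrite lerXn2r ?nnegrE ?mulr_ge0// -mulrA dot_norm_le.
Qed.

(** As functions of [y], the coordinates of [exp (x.Dy) Dy] have this form. They
    are the test functions through which the gradient of the potential is
    followed along a curve of measures. *)
Lemma expR_dot_mul_C1 (z a : vec) :
  let f x := expR (dot z x) * dot a x in
  C1 f /\ grad f = fun x => expR (dot z x) *: (a + dot a x *: z).
Proof.
apply: C1_of_grad => [x|].
  have [d1 e1] := differentiable_expR_dot z x.
  have [d2 e2] := differentiable_dot a x.
  split; first exact: differentiableM.
  move=> v; rewrite (@deriveM _ _ (fun x => expR (dot z x)) (dot a)).
  - rewrite e1 e2 dotZl dotDl dotZl /GRing.scale/=; ring.
  - exact: diff_derivable.
  - exact: diff_derivable.
have cz : continuous (fun x => expR (dot z x)).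
  move=> x; apply: differentiable_continuous.
  by have [] := differentiable_expR_dot z x.
have ca : continuous (dot a).
  by move=> x; apply: differentiable_continuous; have [] := differentiable_dot a x.
move=> x.
apply: (@continuousZ _ _ _ (fun x => expR (dot z x)) (fun x => a + dot a x *: z)).
  exact: cz.
apply: (@continuousD _ _ _ (fun=> a) (fun x => dot a x *: z)).
  exact: cst_continuous.
by apply: continuousZr_tmp; exact: ca.
Qed.

End exponential_test_function.

(** * Calculus on the real line *)

Section real_calculus.
Variable R : realType.
Implicit Types (f g : R -> R) (s t C b M : R).

Lemma is_derive_continuous f g : (forall t, is_derive t (1 : R) f (g t)) ->
  continuous f.
Proof.
move=> df t; apply: differentiable_continuous; apply/derivable1_diffP.
by have [] := df t.
Qed.

Lemma mean_value f g s t : (forall t, is_derive t (1 : R) f (g t)) -> s <= t ->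
  exists2 u, s <= u <= t & f t - f s = g u * (t - s).
Proof.
move=> df st.
have [u] := MVT_segment st (fun x _ => df x)
  (continuous_subspaceT (is_derive_continuous df)).
by rewrite in_itv/= => ut h; exists u.
Qed.

Lemma bounded_derive_lipschitz f g M :
  (forall t, is_derive t (1 : R) f (g t)) -> (forall t, `|g t| <= M) ->
  forall s t, `|f t - f s| <= M * `|t - s|.
Proof.
move=> df gM s t.
wlog st : s t / s <= t => [hw|].
  have [|/ltW] := leP s t; first exact: hw.
  by rewrite distrC (distrC t); exact: hw.
by have [u _ ->] := mean_value df st; rewrite normrM ler_wpM2r.
Qed.

(** A Gronwall-type comparison: integrating a bound that grows like
    [b exp (b |t|)] loses the factor [b]. This gain drives Picard iteration. *)
Lemma exponential_derive_bound f g C b :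
  0 < b -> (forall t, is_derive t (1 : R) f (g t)) ->
  (forall t, `|g t| <= C * b * expR (b * `|t|)) ->
  forall t, `|f t - f 0| <= C * (expR (b * `|t|) - 1).
Proof.
move=> b0.
have pos f1 g1 t : (forall t, is_derive t (1 : R) f1 (g1 t)) ->
    (forall t, `|g1 t| <= C * b * expR (b * `|t|)) -> 0 <= t ->
    f1 t - f1 0 <= C * (expR (b * t) - 1).
  move=> df hg t0.
  (* [h] is nondecreasing on the nonnegative half-line. *)
  pose h (s : R) := C * expR (b * s) - f1 s.
  have dh s : is_derive s (1 : R) h (C * b * expR (b * s) - g1 s).
    have df1 := df s.
    apply: is_derive_eq; rewrite /GRing.scale/=; ring.
  have [u /andP[u0 _]] := mean_value dh t0.
  rewrite /h mulr0 expR0 subr0 mulr1 => e.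
  have : 0 <= (C * b * expR (b * u) - g1 u) * t.
    rewrite mulr_ge0// subr_ge0.
    by have := hg u; rewrite (ger0_norm u0); exact: le_trans (ler_norm _).
  by rewrite -e; lra.
have neg f1 g1 : (forall t, is_derive t (1 : R) f1 (g1 t)) ->
    forall t, is_derive t (1 : R) (fun t => - f1 t) (- g1 t).
  by move=> df t; have df1 := df t; exact: is_deriveN.
have abs f1 g1 t : (forall t, is_derive t (1 : R) f1 (g1 t)) ->
    (forall t, `|g1 t| <= C * b * expR (b * `|t|)) -> 0 <= t ->
    `|f1 t - f1 0| <= C * (expR (b * t) - 1).
  move=> df hg t0; rewrite ler_norml (pos _ _ _ df hg)// andbT.
  have hg' u : `|- g1 u| <= C * b * expR (b * `|u|) by rewrite normrN.
  by have := pos _ _ _ (neg _ _ df) hg' t0; lra.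
move=> df hg t; have [t0|t0] := leP 0 t.
  by rewrite (ger0_norm t0); exact: abs df hg t0.
(* Negative times are reached by reversing time. *)
pose f2 (s : R) := f (- s).
have df2 s : is_derive s (1 : R) f2 (- g (- s)).
  have dfs := df (- s).
  have dN : is_derive s (1 : R) (-%R : R -> R) (- 1) by exact: is_deriveNid.
  have := @is_derive1_comp _ f (-%R) s (g (- s)) (- 1) dfs dN.
  by rewrite mulrN1.
have hg2 s : `|- g (- s)| <= C * b * expR (b * `|s|).
  by rewrite normrN -(normrN s).
have := abs _ _ (- t) df2 hg2; rewrite /f2 opprK oppr0 (ltr0_norm t0); apply.
by rewrite oppr_ge0 ltW.
Qed.

Lemma is_derive_quadratic f C :
  (forall t, `|f t - f 0| <= C * t ^+ 2) -> is_derive (0 : R) (1 : R) f 0.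
Proof.
move=> hf.
have h : h^-1 *: (f (h *: 1 + 0) - f 0) @[h --> 0^'] --> (0 : R).
  apply/cvgrPdist_le => /= e e0; near=> h.
  rewrite sub0r normrN addr0 /GRing.scale/= mulr1 normrM normfV.
  have h0 : 0 < `|h| by rewrite normr_gt0; near: h; exact: nbhs_dnbhs_neq.
  rewrite ler_pdivrMl// (le_trans (hf _))// -real_normK ?num_real//.
  rewrite expr2 mulrA mulrC ler_wpM2l//.
  have : `|h| <= e / (`|C| + 1).
    by near: h; apply: dnbhs0_le; rewrite divr_gt0// ltr_wpDl.
  rewrite ler_pdivlMr ?ltr_wpDl// => /(le_trans _); apply.
  by rewrite mulrC ler_wpM2l// ler_wpDr// ler_norm.
apply: DeriveDef; first by apply/cvg_ex; exists 0.
by apply/cvg_lim.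
Unshelve. all: end_near. Qed.

Lemma lipschitz_continuous_real f M :
  (forall s t, `|f t - f s| <= M * `|t - s|) -> continuous f.
Proof.
move=> hf t; apply/(@cvgrPdist_le _ _ _ (nbhs t)) => /= e e0.
have d0 : 0 < e / (`|M| + 1) by rewrite divr_gt0// ltr_wpDl.
apply: filterS (near_dist_le t d0) => s.
rewrite ler_pdivlMr ?ltr_wpDl// => /(le_trans _); apply.
by rewrite (le_trans (hf _ _))// mulrC ler_wpM2l// ler_wpDr// ler_norm.
Qed.

(** The integral from [-1] gives a primitive on the nonnegative half-line; the
    other half-line is its mirror image, and the two agree to first order at
    [0]. *)
Lemma primitive_exists f : continuous f ->
  exists F : R -> R, F 0 = 0 /\ forall t, is_derive t (1 : R) F (f t).
Proof.
pose P (g : R -> R) (t : R) := (\int[lebesgue_measure]_(s in `[(-1 : R), t]) g s)%R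
  - (\int[lebesgue_measure]_(s in `[(-1 : R), (0 : R)]) g s)%R.
have dP g t : continuous g -> 0 <= t -> is_derive t (1 : R) (P g) (g t).
  move=> cg t0.
  have tu : t < t + 1 by rewrite ltrDl.
  have ig : lebesgue_measure.-integrable `[(-1 : R), t + 1] (EFin \o g).
    apply: continuous_compact_integrable; first exact: segment_compact.
    exact: continuous_subspaceT.
  have t1 : -1 < t by rewrite (lt_le_trans _ t0)// ltrN10.
  have [d1 d2] := continuous_FTC1_closed tu ig t1 (cg t).
  rewrite -[g t]subr0 /P.
  apply: is_deriveB.
  apply: DeriveDef => //.
  by rewrite -derive1E.
move=> cf; pose g s := f (- s).
have cg : continuous g.
  move=> s; apply: (@continuous_comp _ _ _ -%R f); last exact: cf.
  exact: opp_continuous.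
pose N t := - P g (- t).
have dN t : t <= 0 -> is_derive t (1 : R) N (f t).
  move=> t0; have dg : is_derive (- t) (1 : R) (P g) (f t).
    by have := dP g (- t) cg; rewrite oppr_ge0 /g opprK; apply.
  have dn : is_derive t (1 : R) (-%R : R -> R) (- 1) by exact: is_deriveNid.
  have := @is_derive1_comp _ (P g) (-%R) t (f t) (- 1) dg dn.
  by move=> h; have := is_deriveN h; rewrite mulrN1 opprK.
pose F t := if 0 <= t then P f t else N t.
exists F; split; first by rewrite /F lexx /P subrr.
move=> t; have [t0|t0|t0] := ltgtP t 0.
- apply: (@near_eq_is_derive _ _ _ N F).
  + by near=> s; rewrite /F leNgt; have -> : s < 0 by near: s; exact: lt_nbhsl.
  + exact: dN (ltW t0).
- apply: (@near_eq_is_derive _ _ _ (P f) F).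
  + by near=> s; rewrite /F ifT//; apply/ltW; near: s; exact: lt_nbhsr.
  + exact: dP cf (ltW t0).
rewrite t0 => {t t0}.
have q (G : R -> R) l : is_derive (0 : R) (1 : R) G l ->
    h^-1 *: (G (h *: 1 + 0) - G 0) @[h --> 0^'] --> l.
  by move=> [/cvg_ex[/= m Gm] <-]; rewrite /derive (cvg_lim _ Gm).
have h : h^-1 *: (F (h *: 1 + 0) - F 0) @[h --> 0^'] --> f 0.
  have /cvgrPdist_le qP := q _ _ (dP f 0 cf (lexx 0)).
  have /cvgrPdist_le qN := q _ _ (dN 0 (lexx 0)).
  have F0 : F 0 = P f 0 by rewrite /F lexx.
  have F0' : F 0 = N 0 by rewrite F0 /N oppr0 /P !subrr oppr0.
  apply/cvgrPdist_le => e e0; near=> h.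
  rewrite {1}/F; case: ifP => _.
    by rewrite F0; near: h; exact: qP.
  by rewrite F0'; near: h; exact: qN.
by apply: DeriveDef; [apply/cvg_ex; exists (f 0)|apply/cvg_lim].
Unshelve. all: end_near. Qed.

End real_calculus.

(** * Global flow of a bounded Lipschitz field *)

Section geometric.
Variable R : realType.

Lemma le_of_geometric (a b c : R) :
  (forall k, a <= b + c * 2^-1 ^+ k) -> a <= b.
Proof.
move=> h; rewrite leNgt; apply/negP => ba.
have ab : 0 < a - b by rewrite subr_gt0.
have [k hk] : exists k : nat, `|c| / (a - b) < k%:R.
  exists (Num.truncn (`|c| / (a - b))).+1.
  by apply: truncnS_gt.
have k2 : (k%:R : R) <= 2 ^+ k by rewrite -natrX ler_nat ltnW// ltn_expl.
have := lt_le_trans hk k2; rewrite ltr_pdivrMr//.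
have := h k; rewrite exprVn => hc.
have p2 : 0 < (2 : R) ^+ k by rewrite exprn_gt0.
have : a - b <= c * (2 ^+ k)^-1 by move: hc; lra.
rewrite ler_pdivlMr// mulrC => /le_trans /(_ (ler_norm c)) h1.
by move=> /(le_lt_trans h1); rewrite ltxx.
Qed.

(** Keeping the rate of convergence instead of a bare limit makes every later
    passage to the limit an application of [le_of_geometric]. *)
Lemma geometric_limit (u : nat -> R) (c : R) :
  (forall k, `|u k.+1 - u k| <= c * 2^-1 ^+ k) ->
  exists l, forall k, `|u k - l| <= 2 * c * 2^-1 ^+ k.
Proof.
move=> hu.
(* Shifted by the largest error still possible, the sequence is monotone: [v]
   increases, [w] decreases, and [v <= w] squeezes the limit between them. *)
pose v k := u k - 2 * c * 2^-1 ^+ k; pose w k := u k + 2 * c * 2^-1 ^+ k.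
have c0 : 0 <= c by have := hu 0%N; rewrite expr0 mulr1; exact: le_trans.
have vS k : v k <= v k.+1.
  by have := hu k; rewrite ler_norml /v exprS => /andP[]; lra.
have wS k : w k.+1 <= w k.
  by have := hu k; rewrite ler_norml /w exprS => /andP[_]; lra.
have vw k : v k <= w k.
  have : 0 <= 2 * c * 2^-1 ^+ k by rewrite !mulr_ge0// exprn_ge0.
  by rewrite /v /w; lra.
have vmono i j : (i <= j)%N -> v i <= v j.
  move=> ij; rewrite -(subnK ij); elim: (j - i)%N => [|m ih]; first by [].
  by rewrite addSn (le_trans ih).
have wmono i j : (i <= j)%N -> w j <= w i.
  move=> ij; rewrite -(subnK ij); elim: (j - i)%N => [|m ih]; first by [].
  by rewrite addSn (le_trans _ ih).
have vwij i j : v i <= w j.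
  have [ij|/ltnW ji] := leqP i j; first exact: le_trans (vmono _ _ ij) (vw j).
  exact: le_trans (vw i) (wmono _ _ ji).
have ub k : ubound (range v) (w k) by move=> _ [i _ <-].
exists (sup (range v)) => k.
have h1 : v k <= sup (range v).
  apply: ub_le_sup; last by exists k.
  by exists (w 0%N).
have h2 : sup (range v) <= w k.
  by apply: ge_sup; [exists (v 0%N); exists 0%N|exact: ub].
by rewrite ler_norml; move: h1 h2; rewrite /v /w; lra.
Qed.

End geometric.

Section flow.
Variables (R : realType) (n : nat).
Local Notation vec := 'cV[R]_n.

(** Totalised with a junk value, so that the Picard iterates can be defined
    before they are known to be continuous. *)
Definition primitive (f : R -> R) : R -> R :=
  if pselect (continuous f) is left cf then sval (cid (primitive_exists cf))
  else f.

Lemma primitiveP f : continuous f ->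
  primitive f 0 = 0 /\ forall t, is_derive t (1 : R) (primitive f) (f t).
Proof.
by move=> cf; rewrite /primitive; case: pselect => // cf'; case: cid.
Qed.

(** The vector equation [gam' = v], read coordinate by coordinate. *)
Definition is_curve (gam v : R -> vec) :=
  forall t i, is_derive t (1 : R) (fun s => gam s i ord0) (v t i ord0).

Lemma is_curveB gam1 v1 gam2 v2 : is_curve gam1 v1 -> is_curve gam2 v2 ->
  is_curve (fun t => gam1 t - gam2 t) (fun t => v1 t - v2 t).
Proof.
move=> h1 h2 t i; have d1 := h1 t i; have d2 := h2 t i; rewrite !mxE.
have -> : (fun s => (gam1 s - gam2 s) i ord0) =
    (fun s => gam1 s i ord0) - (fun s => gam2 s i ord0).
  by apply/funext => s; rewrite !mxE.
exact: is_deriveB.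
Qed.

Lemma is_curve_exponential gam v (C b : R) : 0 < b -> 0 <= C ->
  is_curve gam v -> (forall t, `|v t| <= C * b * expR (b * `|t|)) ->
  forall t, `|gam t - gam 0| <= C * (expR (b * `|t|) - 1).
Proof.
move=> b0 C0 dg hv t; apply: norm_le_coord => [|i].
  by rewrite mulr_ge0// subr_ge0 -expR0 ler_expR mulr_ge0// ltW.
rewrite !mxE; have h t' : `|v t' i ord0| <= C * b * expR (b * `|t'|).
  exact: le_trans (coord_le _ _) (hv t').
exact: exponential_derive_bound b0 (fun t => dg t i) h t.
Qed.

Lemma is_curve_lipschitz gam v (M : R) : 0 <= M ->
  is_curve gam v -> (forall t, `|v t| <= M) ->
  forall s t, `|gam t - gam s| <= M * `|t - s|.
Proof.
move=> M0 dg hv s t; apply: norm_le_coord => [|i]; first by rewrite mulr_ge0.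
rewrite !mxE; have h t' : `|v t' i ord0| <= M.
  exact: le_trans (coord_le _ _) (hv t').
exact: bounded_derive_lipschitz (fun t => dg t i) h s t.
Qed.

Variables (F : vec -> vec) (L M : R).
Hypothesis L_gt0 : 0 < L.
Hypothesis M_ge0 : 0 <= M.
Hypothesis F_bounded : forall x, `|F x| <= M.
Hypothesis F_lip : forall x y, `|F x - F y| <= L * `|x - y|.

Let E (t : R) : R := expR (2 * L * `|t|).
(* [A] makes [A * (2 * L)] equal to [M], the bound on the speed. *)
Let A : R := M / (2 * L).

Let b_gt0 : 0 < 2 * L. Proof. by rewrite mulr_gt0. Qed.
Let b_ge0 : 0 <= 2 * L. Proof. exact: ltW. Qed.
Let L_ge0 : 0 <= L. Proof. exact: ltW. Qed.
Let E_ge1 t : 1 <= E t.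
Proof. by rewrite (le_trans _ (expR_ge1Dx _))// lerDl mulr_ge0. Qed.
Let E_ge0 t : 0 <= E t. Proof. exact: expR_ge0. Qed.
Let A_ge0 : 0 <= A. Proof. by rewrite divr_ge0. Qed.

Fixpoint picard k (x : vec) (t : R) : vec :=
  if k is k'.+1 then
    \col_i (x i ord0 + primitive (fun s => F (picard k' x s) i ord0) t)
  else x.

Lemma continuous_field_along (gam : R -> vec) i :
  (forall s t, `|gam t - gam s| <= M * `|t - s|) ->
  continuous (fun s => F (gam s) i ord0).
Proof.
move=> hg; apply: (@lipschitz_continuous_real _ _ (L * M)) => s t.
have := coord_le (F (gam t) - F (gam s)) i; rewrite !mxE => /le_trans; apply.
by rewrite (le_trans (F_lip _ _))// -mulrA ler_wpM2l.
Qed.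

Lemma curve_of_primitive (gam : R -> vec) (x : vec) :
  (forall i, continuous (fun s => F (gam s) i ord0)) ->
  let h t : vec := \col_i (x i ord0 + primitive (fun s => F (gam s) i ord0) t) in
  h 0 = x /\ is_curve h (fun t => F (gam t)).
Proof.
move=> cF h; split.
  by apply: eq_col => i; rewrite mxE (primitiveP (cF i)).1 addr0.
move=> t i; have dp := (primitiveP (cF i)).2 t.
have -> : (fun s => h s i ord0) =
    cst (x i ord0) + primitive (fun s => F (gam s) i ord0).
  by apply/funext => s; rewrite mxE.
by rewrite -[F (gam t) i ord0]add0r; exact: is_deriveD.
Qed.

Lemma picard_lip k x s t : `|picard k x t - picard k x s| <= M * `|t - s|.
Proof.
elim: k s t => [|k ih] s t; first by rewrite subrr normr0 mulr_ge0.
have [_ hc] := curve_of_primitive x (fun i => continuous_field_along (i := i) ih).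
by apply: (is_curve_lipschitz M_ge0 hc) => u.
Qed.

Lemma picard_curve k x :
  picard k.+1 x 0 = x /\ is_curve (picard k.+1 x) (fun t => F (picard k x t)).
Proof.
apply: curve_of_primitive => i.
exact: continuous_field_along (picard_lip k x).
Qed.

Lemma picard0 k x : picard k x 0 = x.
Proof. by case: k => // k; exact: (picard_curve k x).1. Qed.

(** One step multiplies a gap [K exp (2 L |t|)] by [L] through the field, and
    by [1 / (2 L)] through the primitive. *)
Lemma picard_gap k x t :
  `|picard k.+1 x t - picard k x t| <= A * E t * 2^-1 ^+ k.
Proof.
elim: k t => [|k ih] t.
  have [p0 hc] := picard_curve 0 x.
  rewrite expr0 mulr1 -[X in _ - X](picard0 1 x).
  apply: le_trans (is_curve_exponential b_gt0 A_ge0 hc _ _) _.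
    move=> u; rewrite (le_trans (F_bounded _))// /A divfK ?gt_eqF//.
    by rewrite -/(E u) ler_peMr.
  by rewrite ler_wpM2l// gerBl.
have [_ hc1] := picard_curve k.+1 x; have [_ hc2] := picard_curve k x.
have C0 : 0 <= A * 2^-1 ^+ k.+1 by rewrite mulr_ge0// exprn_ge0.
have := is_curve_exponential b_gt0 C0 (is_curveB hc1 hc2).
rewrite !picard0 subrr => h.
have {}h := h _ t; rewrite subr0 in h.
apply: le_trans (h _) _ => [u|].
  rewrite (le_trans (F_lip _ _))//.
  have -> : A * 2^-1 ^+ k.+1 * (2 * L) * expR (2 * L * `|u|) =
            L * (A * E u * 2^-1 ^+ k) by rewrite exprS /E; field.
  by rewrite ler_wpM2l.
rewrite mulrAC ler_wpM2r ?exprn_ge0// ler_wpM2l// gerBl//.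
Qed.

(** The bound does not depend on [k], hence passes to the limit. *)
Lemma picard_dependence k x y t :
  `|picard k x t - picard k y t| <= `|x - y| * E t.
Proof.
elim: k t => [|k ih] t; first by rewrite ler_peMr.
have [_ hc1] := picard_curve k x; have [_ hc2] := picard_curve k y.
have C0 : 0 <= `|x - y| / 2 by rewrite divr_ge0.
have := is_curve_exponential b_gt0 C0 (is_curveB hc1 hc2).
rewrite !picard0 => h; have {}h := h _ t.
rewrite -[X in `|X|](subrK (x - y)) (le_trans (ler_normD _ _))//.
apply: le_trans (lerD (h _) (lexx _)) _ => [u|].
  rewrite (le_trans (F_lip _ _))//.
  have -> : `|x - y| / 2 * (2 * L) * expR (2 * L * `|u|) =
            L * (`|x - y| * E u) by rewrite /E; field.
  by rewrite ler_wpM2l.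
have := E_ge1 t; rewrite -/(E t) => Et.
have : 0 <= `|x - y| * (E t - 1) by rewrite mulr_ge0// subr_ge0.
by lra.
Qed.

Lemma picard_limit x t : exists l : vec,
  forall k, `|picard k x t - l| <= 2 * (A * E t) * 2^-1 ^+ k.
Proof.
have h i : exists l, forall k,
    `|picard k x t i ord0 - l| <= 2 * (A * E t) * 2^-1 ^+ k.
  apply: geometric_limit => k; apply: le_trans (picard_gap k x t).
  by have := coord_le (picard k.+1 x t - picard k x t) i; rewrite !mxE.
have [l hl] := choice h.
exists (\col_i l i) => k; apply: norm_le_coord => [|i]; last by rewrite !mxE.
by rewrite mulr_ge0 ?exprn_ge0// mulr_ge0// mulr_ge0.
Qed.

(** Global Picard-Lindelof for a bounded Lipschitz field: in the norm weighted
    by [exp (2 L |t|)] each Picard step halves the error, so the iterates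
    converge for all times at once. *)
Lemma bounded_lipschitz_flow : exists Phi : R -> vec -> vec,
  [/\ forall x, Phi 0 x = x,
      forall x, is_curve (fun t => Phi t x) (fun t => F (Phi t x)) &
      forall t x y, `|Phi t x - Phi t y| <= expR (2 * L * `|t|) * `|x - y|].
Proof.
pose Phi t x := sval (cid (picard_limit x t)).
have hPhi t x k : `|picard k x t - Phi t x| <= 2 * (A * E t) * 2^-1 ^+ k.
  exact: (svalP (cid (picard_limit x t))).
have Phi_lip x s t : `|Phi t x - Phi s x| <= M * `|t - s|.
  apply: (@le_of_geometric _ _ _ (2 * (A * E t) + 2 * (A * E s))) => k.
  have -> : Phi t x - Phi s x = (picard k x t - picard k x s)
      - (picard k x t - Phi t x) + (picard k x s - Phi s x).
    by apply: eq_col => i; rewrite !mxE; ring.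
  rewrite (le_trans (ler_normD _ _))// mulrDl addrA lerD//.
  by rewrite (le_trans (ler_normB _ _))// lerD// picard_lip.
have cF x i : continuous (fun s => F (Phi s x) i ord0).
  exact: continuous_field_along (Phi_lip x).
(* The limit solves the integral equation, because its right-hand side [h] is
   within [O(2^-k)] of the next Picard iterate. *)
have PhiE x t : Phi t x =
    \col_i (x i ord0 + primitive (fun s => F (Phi s x) i ord0) t).
  pose h t : vec := \col_i (x i ord0 + primitive (fun s => F (Phi s x) i ord0) t).
  have [h0 hc] : h 0 = x /\ is_curve h (fun t => F (Phi t x)).
    exact: curve_of_primitive x (cF x).
  rewrite -/(h t).
  apply/eqP; rewrite -subr_eq0 -normr_le0.
  apply: (@le_of_geometric _ _ _ (2 * (A * E t))) => k; rewrite add0r.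
  have [_ hc1] := picard_curve k x.
  have C0 : 0 <= A * 2^-1 ^+ k by rewrite mulr_ge0// exprn_ge0.
  have := is_curve_exponential b_gt0 C0 (is_curveB hc1 hc).
  rewrite picard0 h0 subrr => hh; have {}hh := hh _ t; rewrite subr0 in hh.
  have -> : Phi t x - h t = (picard k.+1 x t - h t) - (picard k.+1 x t - Phi t x).
    by apply: eq_col => i; rewrite !mxE; ring.
  rewrite (le_trans (ler_normB _ _))//.
  apply: le_trans (lerD (hh _) (hPhi t x k.+1)) _ => [u|].
    rewrite (le_trans (F_lip _ _))//.
    have -> : A * 2^-1 ^+ k * (2 * L) * expR (2 * L * `|u|) =
            L * (2 * (A * E u) * 2^-1 ^+ k) by rewrite /E; ring.
    by rewrite ler_wpM2l.
  rewrite exprS -/(E t).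
  have : 0 <= A * 2^-1 ^+ k by [].
  by lra.
exists Phi; split.
- move=> x; apply/eqP; rewrite -subr_eq0 -normr_le0.
  apply: (@le_of_geometric _ _ _ (2 * (A * E 0))) => k; rewrite add0r.
  by have := hPhi 0 x k; rewrite picard0 distrC.
- move=> x; have [_ hc] := curve_of_primitive x (cF x).
  have {1}-> : (fun t => Phi t x) = (fun t =>
      \col_i (x i ord0 + primitive (fun s => F (Phi s x) i ord0) t)).
    by apply/funext => t; rewrite PhiE.
  exact: hc.
- move=> t x y; rewrite mulrC.
  apply: (@le_of_geometric _ _ _ (2 * (A * E t) + 2 * (A * E t))) => k.
  have -> : Phi t x - Phi t y = (picard k x t - picard k y t)
      - (picard k x t - Phi t x) + (picard k y t - Phi t y).
    by apply: eq_col => i; rewrite !mxE; ring.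
  rewrite (le_trans (ler_normD _ _))// [X in _ <= _ + X]mulrDl addrA lerD//.
  by rewrite (le_trans (ler_normB _ _))// lerD// picard_dependence.
Qed.

End flow.

(** * Existence of perturbations *)

Section curves.
Variables (R : realType) (n : nat).
Local Notation vec := 'cV[R]_n.
Local Notation S := (sphere R n).
Implicit Types (gam v : R -> vec).

Lemma is_curve_comp (phi : vec -> R) gam v : C1 phi -> is_curve gam v ->
  forall t, is_derive t (1 : R) (fun s => phi (gam s)) (dot (grad phi (gam t)) (v t)).
Proof.
move=> [dphi _] hg t.
have dg : derivable gam t 1.
  by apply/derivable_mxP => i j; rewrite ord1; have [] := hg t i.
have dgE : 'D_1 gam t = v t.
  rewrite derive_mx//; apply: eq_col => i; rewrite mxE.
  by have [_ <-] := hg t i.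
have dg' : differentiable gam t by apply/derivable1_diffP.
have dc : differentiable (phi \o gam) t by apply: differentiable_comp.
apply: DeriveDef; first exact: diff_derivable.
rewrite (_ : (fun s => phi (gam s)) = phi \o gam)// deriveE// diff_comp//=.
by rewrite -(derive_grad _ (dphi _)) deriveE// -dgE deriveE.
Qed.

Lemma is_curve_sq_norm gam v : is_curve gam v ->
  forall t, is_derive t (1 : R) (fun s => dot (gam s) (gam s)) (2 * dot (gam t) (v t)).
Proof.
move=> hg t.
pose h (i : 'I_n) (s : R) := gam s i ord0 * gam s i ord0.
have -> : (fun s => dot (gam s) (gam s)) = \sum_i h i.
  by apply/funext => s; rewrite fct_sumE.
have -> : 2 * dot (gam t) (v t) = \sum_i (2 * (gam t i ord0 * v t i ord0)).
  by rewrite -mulr_sumr.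
apply: is_derive_sum => i.
have d := hg t i.
have dd := @is_deriveM _ _ (fun s => gam s i ord0) (fun s => gam s i ord0) t 1 _ _ d d.
by apply: is_derive_eq; rewrite /GRing.scale/=; ring.
Qed.

End curves.

Section cutoff.
Variables (R : realType) (n : nat).
Local Notation vec := 'cV[R]_n.

(** Multiplying by this factor turns a locally Lipschitz field into a bounded
    and globally Lipschitz one without changing it on the unit sphere. *)
Definition cutoff (x : vec) : R := Num.max 0 (Num.min 1 (2 - `|x|)).

Lemma cutoff_unit x : `|x| <= 1 -> cutoff x = 1.
Proof.
move=> x1; rewrite /cutoff min_l; last by move: x1; lra.
by rewrite max_r.
Qed.

Lemma cutoff_out x : 2 <= `|x| -> cutoff x = 0.
Proof.
move=> x2; rewrite /cutoff min_r; last by move: x2; lra.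
by rewrite max_l//; move: x2; lra.
Qed.

Lemma cutoff_norm_le1 x : `|cutoff x| <= 1.
Proof.
rewrite ger0_norm /cutoff; first by rewrite ge_max ler01 ge_min lexx.
by rewrite le_max lexx.
Qed.

Lemma cutoff_lip x y : `|cutoff x - cutoff y| <= `|x - y|.
Proof.
apply: le_trans (ler_dist_dist x y); rewrite /cutoff.
move: `|x| `|y| => a b.
have := ler_norm (b - a); rewrite (distrC b) ler_norml.
move: `|a - b| (ler_norm (a - b)) => N h1 h2.
case: (leP 1 (2 - a)) => ha; case: (leP 1 (2 - b)) => hb;
  do 2?[case: (leP 0 _) => ?]; apply/andP; split; lra.
Qed.

Lemma cutoff_lipschitz (G : vec -> vec) : lip_ball 2 G ->
  exists L M, [/\ 0 < L, 0 <= M, forall x, `|cutoff x *: G x| <= M &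
    forall x y, `|cutoff x *: G x - cutoff y *: G y| <= L * `|x - y|].
Proof.
move=> [C C0 hG].
have GC x : `|x| <= 2 -> `|G x| <= C by move=> x2; have [] := hG x x x2 x2.
exists (2 * C + 1), C; split => [|//|x|x y].
- by rewrite ltr_wpDl// mulr_ge0.
- have [x2|/ltW x2] := leP `|x| 2; last by rewrite cutoff_out// scale0r normr0.
  rewrite normrZ -[leRHS]mul1r ler_pM//; [exact: cutoff_norm_le1|exact: GC].
apply: (@le_trans _ _ (2 * C * `|x - y|)); last by rewrite ler_wpM2r// lerDl.
(* When one of the points is out of the ball of radius 2, only the variation of
   the cutoff is seen. *)
wlog xy : x y / `|x| <= `|y| => [hw|].
  have [|/ltW] := leP `|x| `|y|; first exact: hw.
  by rewrite distrC (distrC x); exact: hw.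
have [x2|/ltW x2] := leP `|x| 2; last first.
  rewrite !cutoff_out ?(le_trans x2)// !scale0r subr0 normr0.
  by rewrite !mulr_ge0.
have C2 : C * `|x - y| <= 2 * C * `|x - y|.
  by rewrite ler_wpM2r// ler_peMl// ler1n.
have [y2|/ltW y2] := leP `|y| 2.
  have -> : cutoff x *: G x - cutoff y *: G y =
      (cutoff x - cutoff y) *: G x + cutoff y *: (G x - G y).
    by rewrite scalerBl scalerBr addrA subrK.
  rewrite (le_trans (ler_normD _ _))// !normrZ.
  have -> : 2 * C * `|x - y| = `|x - y| * C + 1 * (C * `|x - y|) by ring.
  apply: lerD; first by rewrite ler_pM// ?cutoff_lip// GC.
  by rewrite ler_pM// ?cutoff_norm_le1//; have [] := hG x y x2 y2.
rewrite (cutoff_out y2) scale0r subr0; apply: le_trans C2.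
rewrite -[cutoff x]subr0 -(cutoff_out y2) normrZ mulrC.
by rewrite ler_pM// ?cutoff_lip// GC.
Qed.

End cutoff.

Section perturbation_existence.
Variables (R : realType) (n : nat).
Local Notation vec := 'cV[R]_n.
Local Notation S := (sphere R n).

(** The field [x |-> (x.x) W - (x.W) x] is tangent to every centred sphere, so
    its flow preserves the norm; on the unit sphere it is [Pperp W]. *)
Lemma sphere_flow (W : vec -> vec) : [lipschitz W x | x in [set: vec]] ->
  exists Phi : R -> vec -> vec,
  [/\ forall x, Phi 0 x = x, forall t, continuous (Phi t),
      forall t x, S (Phi t x) <-> S x &
      forall x, S x ->
        is_curve (fun t => Phi t x) (fun t => Pperp (Phi t x) *m W (Phi t x))].
Proof.
move=> lW; have bW := lip_ball_lipschitz 2 lW.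
pose G x := dot x x *: W x + (- 1 * dot x (W x)) *: x.
have lG : lip_ball 2 G.
  apply: lip_ballD; apply: lip_ballZ => //.
  - exact: lip_ball_dot (lip_ball_id _ _) (lip_ball_id _ _).
  - apply: (@lip_ballZ _ _ _ R^o); last exact: lip_ball_dot (lip_ball_id _ _) bW.
    exists 1 => // x y _ _; rewrite subrr normr0 normrN normr1 mulr_ge0//.
  - exact: lip_ball_id.
have [L [M [L0 M0 bF lF]]] := cutoff_lipschitz lG.
have [Phi [Phi0 Phic Phil]] := bounded_lipschitz_flow L0 M0 bF lF.
have tangent x : dot x (cutoff x *: G x) = 0.
  by rewrite dotZr /G dotDr !dotZr; ring.
have inv x t : dot (Phi t x) (Phi t x) = dot x x.
  have h s : is_derive s (1 : R) (fun s => dot (Phi s x) (Phi s x)) 0.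
    by have := is_curve_sq_norm (Phic x) s; rewrite tangent mulr0.
  have := @bounded_derive_lipschitz _ _ (fun=> 0) 0 h _ 0 t.
  rewrite mul0r Phi0 => hh; apply/eqP; rewrite -subr_eq0 -normr_le0.
  by apply: hh => s; rewrite normr0.
have invS t x : S (Phi t x) <-> S x by rewrite !sphere_dot inv.
exists Phi; split => //.
- move=> t x; apply/(@cvgrPdist_le _ _ _ (nbhs x)) => /= e e0.
  have d0 : 0 < e / expR (2 * L * `|t|) by rewrite divr_gt0// expR_gt0.
  apply: filterS (near_dist_le x d0) => y.
  rewrite ler_pdivlMr ?expR_gt0// mulrC.
  exact: le_trans (Phil _ _ _).
- move=> x Sx t i.
  have St : S (Phi t x) by apply/invS.
  have := Phic x t i.
  rewrite cutoff_unit ?scale1r; last exact: sphere_norm_le1.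
  rewrite /G; move/sphere_dot : (St) => ->.
  by rewrite scale1r mulN1r scaleNr -PperpE.
Qed.

Lemma continuous_sgrad (phi : vec -> R) : C1 phi -> continuous (sgrad phi).
Proof.
move=> [_ cg].
have -> : sgrad phi = (fun x => \col_i (grad phi x i ord0
    - dot x (grad phi x) * x i ord0)).
  by apply/funext => x; apply: eq_col => i; rewrite /sgrad PperpE !mxE.
have cid : continuous (fun x : vec => x) by move=> x; exact: cvg_id.
apply: continuous_col => i; apply: continuous_sub; first exact: continuous_coord.
by apply: continuous_mul; [exact: continuous_dot|exact: continuous_coord].
Qed.

Lemma continuous_sgrad_dot (phi : vec -> R) (W : vec -> vec) :
  C1 phi -> continuous W -> continuous (fun x => dot (sgrad phi x) (W x)).
Proof. by move=> C1phi cW; apply: continuous_dot => //; exact: continuous_sgrad. Qed.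

Lemma lipschitz_continuous (W : vec -> vec) :
  [lipschitz W x | x in [set: vec]] -> continuous W.
Proof. by move=> lW; apply: lip_ball_continuous => r; exact: lip_ball_lipschitz. Qed.

(** The weak equation is the chain rule along trajectories, differentiated under
    the integral sign. The derivative is bounded uniformly in time because the
    trajectories stay on the sphere. *)
Lemma perturbation_exists (W : vec -> vec) (mu : probability (borelE R n) R) :
  on_sphere mu -> [lipschitz W x | x in [set: vec]] ->
  exists mu_, perturbation W mu mu_.
Proof.
move=> muS lW; have [Phi [Phi0 cPhi SPhi dPhi]] := sphere_flow lW.
have mPhi t : measurable_fun setT (Phi t : borelE R n -> borelE R n).
  exact: continuous_measurable_borelE_map.
pose X t : {mfun borelE R n >-> borelE R n} :=
  HB.pack (Phi t : borelE R n -> borelE R n) (isMeasurableFun.Build _ _ _ _ _ (mPhi t)).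
have preS t : Phi t @^-1` S = S by apply/seteqP; split => x h; apply/(SPhi t x).
have intE (phi : vec -> R) t : continuous phi ->
    (\int[distribution mu (X t)]_(x in S) phi x)%R =
    (\int[mu]_(x in S) phi (Phi t x))%R.
  move=> cphi; congr fine; rewrite integral_pushforward//=.
  - by rewrite preS.
  - by apply/measurable_EFinP; exact: continuous_measurable_borelE.
  - rewrite preS; apply: (@continuous_integrable _ _ _ (phi \o Phi t)) => x.
    by apply: continuous_comp; [exact: cPhi|exact: cphi].
  - exact: sphere_measurable.
exists (fun t => distribution mu (X t)); split.
- by move=> t; change (mu (Phi t @^-1` S) = 1%E); rewrite preS.
- move=> A mA; change (mu (Phi 0 @^-1` A) = mu A); congr (mu _).
  by apply/seteqP; split => x; rewrite /= Phi0.
move=> phi C1phi t.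
have cphi := C1_continuous C1phi.
pose g x := dot (sgrad phi x) (W x).
have cg : continuous g.
  by apply: continuous_sgrad_dot => //; exact: lipschitz_continuous.
rewrite [X in is_derive _ _ X _](_ : _ =
  fun s => (\int[mu]_(x in S) phi (Phi s x))%R); last first.
  by apply/funext => s; exact: intE.
rewrite intE//.
have dphi x s : S x -> is_derive s (1 : R) (fun s => phi (Phi s x)) (g (Phi s x)).
  move=> Sx; have := is_curve_comp C1phi (dPhi x Sx) s.
  rewrite /g /sgrad dot_Pperp PperpE dotBr dotZr (dotC _ (Phi s x)).
  by rewrite (mulrC (dot _ (W _))).
have [C C0 hC] := continuous_bounded_sphere cg.
have cphiPhi s : continuous (fun x => phi (Phi s x)).
  by move=> x; apply: continuous_comp; [exact: cPhi|exact: cphi].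
have part x s : S x -> partial1of2 (fun s x => phi (Phi s x)) s x = g (Phi s x).
  by move=> Sx; rewrite partial1of2E; have [_ <-] := dphi x s Sx.
have := @cvg_differentiation_under_integral R _ (borelE R n) mu
  (fun s x => phi (Phi s x)) S (@sphere_measurable _ _) t (t - 1) (t + 1)
  _ _ _ (fun=> C) _ _ _.
have -> : (\int[mu]_(x in S) partial1of2 (fun s x => phi (Phi s x)) t x)%R =
    (\int[mu]_(x in S) g (Phi t x))%R.
  by apply: eq_Rintegral => x /set_mem Sx; exact: part.
move=> h.
have {}h : h^-1 *: ((\int[mu]_(x in S) phi (Phi (h + t) x))%R -
    (\int[mu]_(x in S) phi (Phi t x))%R) @[h --> 0^'] -->
    (\int[mu]_(x in S) g (Phi t x))%R.
  apply: h => //.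
  - by rewrite /= in_itv/= ltrBlDr ltrDl ltr01.
  - by move=> s _; exact: continuous_integrable.
  - by move=> s x _ Sx; have [] := dphi x s Sx.
  - by apply: (@continuous_integrable _ _ _ (fun=> C)) => x; exact: cst_continuous.
  - by move=> s x _ Sx; rewrite part// hC//; apply/SPhi.
have {}h : h^-1 *: ((\int[mu]_(x in S) phi (Phi (h *: 1 + t) x))%R -
    (\int[mu]_(x in S) phi (Phi t x))%R) @[h --> 0^'] -->
    (\int[mu]_(x in S) g (Phi t x))%R.
  by under eq_fun do rewrite /GRing.scale/= mulr1.
rewrite -/(g _) /=; apply: DeriveDef.
  by apply/cvg_ex; exists (\int[mu]_(x in S) g (Phi t x))%R.
by apply/cvg_lim.
Qed.

End perturbation_existence.

(** * Symmetry of the energy *)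

Section energy.
Variables (R : realType) (n : nat) (D : 'M[R]_n).
Hypothesis D_sym : D^T = D.
Local Notation vec := 'cV[R]_n.
Local Notation S := (sphere R n).
Local Notation prob := (probability (borelE R n) R).

Lemma kernel_sym x y : dot x (D *m y) = dot y (D *m x).
Proof. by rewrite dot_mulmxl D_sym dotC. Qed.

Lemma integral_indic_sphere (nu : prob) (h : vec -> R) :
  (\int[nu]_z (\1_S (z : vec) * h z)%:E = \int[nu]_(z in S) (h z)%:E)%E.
Proof.
rewrite [RHS]integral_mkcond; apply: eq_integral => z _.
by rewrite patchE indicE; case: (z \in S); rewrite ?mul1r ?mul0r.
Qed.

Lemma potential_EFin (nu : prob) y :
  (\int[nu]_(z in S) (expR (dot y (D *m z)))%:E = (potential D nu y)%:E)%E.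
Proof.
rewrite /potential /Rintegral fineK//; apply: integrable_fin_num.
  exact: sphere_measurable.
exact/continuous_integrable/continuous_expR_dot.
Qed.

Lemma coord_measurable (i : 'I_n) :
  measurable_fun setT (fun x : borelE R n => (x : vec) i ord0).
Proof. by apply: continuous_measurable_borelE; exact: coord_continuous. Qed.

Lemma kernel_measurable : measurable_fun setT
  (fun p : borelE R n * borelE R n => dot (p.1 : vec) (D *m (p.2 : vec))).
Proof.
apply: measurable_sum => i; apply: measurable_funM.
  exact: (measurableT_comp (coord_measurable i) measurable_fst).
rewrite [X in measurable_fun _ X](_ : _ = fun p : borelE R n * borelE R n =>
  \sum_j D i j * (p.2 : vec) j ord0).
  apply: measurable_sum => j; apply: measurable_funM => //.
  exact: (measurableT_comp (coord_measurable j) measurable_snd).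
by apply/funext => p; rewrite mxE.
Qed.

(** Fubini-Tonelli for the positive symmetric kernel [exp (x.Dy)]; the
    indicators bring the integrals over the sphere to the whole space. *)
Lemma potential_duality (nu rho : prob) : on_sphere nu -> on_sphere rho ->
  (\int[rho]_(y in S) potential D nu y)%R =
  (\int[nu]_(x in S) potential D rho x)%R.
Proof.
move=> nuS rhoS.
pose k (p : borelE R n * borelE R n) : \bar R :=
  (\1_S (p.1 : vec) * (\1_S (p.2 : vec) * expR (dot (p.1 : vec) (D *m p.2))))%:E.
have mS : measurable_fun setT (fun x : borelE R n => \1_S (x : vec) : R).
  exact: (@measurable_indic _ (borelE R n) R setT S (@sphere_measurable R n)).
have mk : measurable_fun setT k.
  apply/measurable_EFinP; apply: measurable_funM.
    exact: (measurableT_comp mS measurable_fst).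
  apply: measurable_funM.
    exact: (measurableT_comp mS measurable_snd).
  by apply: measurableT_comp => //; exact: kernel_measurable.
have k0 p : (0 <= k p)%E by rewrite lee_fin !mulr_ge0 ?expR_ge0// indicE.
congr fine.
have h1 y : (\int[nu]_z k (y, z) = (\1_S (y : vec) * potential D nu y)%:E)%E.
  rewrite /k/= indicE; have [yS|yS] := boolP (y \in S).
    under eq_integral do rewrite mul1r.
    by rewrite integral_indic_sphere mul1r potential_EFin.
  by under eq_integral do rewrite mul0r; rewrite integral0 mul0r.
have h2 z : (\int[rho]_y k (y, z) = (\1_S (z : vec) * potential D rho z)%:E)%E.
  rewrite /k/= indicE; have [zS|zS] := boolP (z \in S).
    under eq_integral do rewrite mul1r kernel_sym.
    by rewrite integral_indic_sphere mul1r potential_EFin.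
  by under eq_integral do rewrite mul0r mulr0; rewrite integral0 mul0r.
rewrite -!integral_indic_sphere.
under eq_integral do rewrite -h1.
under [RHS]eq_integral do rewrite -h2.
exact: fubini_tonelli.
Qed.

Lemma energyE (nu : prob) : energy D nu = (\int[nu]_(y in S) potential D nu y)%R.
Proof.
rewrite /energy; apply: eq_Rintegral => y _; apply: eq_Rintegral => x _.
by rewrite kernel_sym.
Qed.

End energy.

(** * The first variation formula *)

Section first_variation.
Variables (R : realType) (n : nat) (D : 'M[R]_n).
Hypothesis D_sym : D^T = D.
Local Notation vec := 'cV[R]_n.
Local Notation S := (sphere R n).
Local Notation prob := (probability (borelE R n) R).

Lemma dot_Pperp_le (x g w : vec) : S x ->
  `|dot (Pperp x *m g) w| <= (n%:R + n%:R * n%:R) * (`|g| * `|w|).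
Proof.
move=> /sphere_norm_le1 x1; rewrite dot_Pperp (le_trans (ler_normB _ _))//.
rewrite mulrDl lerD ?dot_norm_le// normrM.
have -> : n%:R * n%:R * (`|g| * `|w|) = n%:R * `|g| * (n%:R * `|w|) by ring.
have h u : `|dot x u| <= n%:R * `|u|.
  by rewrite (le_trans (dot_norm_le _ _))// ler_wpM2l// ler_piMl.
by rewrite ler_pM.
Qed.

Lemma Rintegral_eq_measure (nu rho : prob) (f : vec -> R) :
  (forall A : set (borelE R n), measurable A -> nu A = rho A) ->
  (\int[nu]_(x in S) f x)%R = (\int[rho]_(x in S) f x)%R.
Proof.
by move=> h; congr fine; apply: eq_measure_integral => A mA _; exact: h.
Qed.

Variables (W : vec -> vec) (mu : prob) (mu_ : R -> prob).
Hypothesis lW : [lipschitz W x | x in [set: vec]].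
Hypothesis pert : perturbation W mu mu_.

Let muS t : on_sphere (mu_ t). Proof. by have [] := pert. Qed.
Let dmu (phi : vec -> R) : C1 phi -> forall t, is_derive t (1 : R)
  (fun s : R => (\int[mu_ s]_(x in S) phi x)%R)
  (\int[mu_ t]_(x in S) dot (sgrad phi x) (W x))%R.
Proof. by have [_ _] := pert; apply. Qed.

Let cW : continuous W. Proof. exact: lipschitz_continuous. Qed.

Lemma field_bounded_sphere : exists2 C, 0 <= C & forall x, S x -> `|W x| <= C.
Proof.
have [C C0 hC] := lip_ball_lipschitz 1 lW.
by exists C => // x /sphere_norm_le1 x1; have [] := hC x x x1 x1.
Qed.

Let row_vec i : vec := \col_j D i j.

Lemma row_vecE i x : (D *m x) i ord0 = dot (row_vec i) x.
Proof. by rewrite mxE; apply: eq_bigr => j _; rewrite mxE. Qed.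

Lemma row_vec_le i : `|row_vec i| <= `|D|.
Proof.
apply: norm_le_coord => // j; rewrite mxE [leRHS]/Num.Def.normr/= mx_normrE.
exact: (le_bigmax _ (fun ij : 'I_n * 'I_n => `|D ij.1 ij.2|) (i, j)).
Qed.

Lemma potential_grad_test (nu : prob) y i : potential_grad D nu y i ord0 =
  (\int[nu]_(x in S) (expR (dot (D *m y) x) * dot (row_vec i) x))%R.
Proof.
rewrite mxE; apply: eq_Rintegral => x _.
by rewrite row_vecE dot_mulmxl D_sym.
Qed.

(** Each coordinate of the gradient at [y] is the integral of a C1 function
    against [mu_t], so the weak equation bounds its speed, uniformly in [y]. *)
Lemma potential_grad_variation : exists2 c, 0 <= c &
  forall t y, S y ->
    `|potential_grad D (mu_ t) y - potential_grad D (mu_ 0) y| <= c * `|t|.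
Proof.
have [w w0 hw] := field_bounded_sphere.
pose d := n%:R * `|D|.
have d0 : 0 <= d by rewrite mulr_ge0.
pose c := (n%:R + n%:R * n%:R) *
  ((expR (n%:R * d) * (`|D| + n%:R * `|D| * d)) * w) : R.
have c0 : 0 <= c.
  by rewrite mulr_ge0 ?addr_ge0 ?mulr_ge0 ?expR_ge0 ?addr_ge0 ?mulr_ge0.
exists c => // t y Sy; apply: norm_le_coord => [|i]; first by rewrite mulr_ge0.
pose f x := expR (dot (D *m y) x) * dot (row_vec i) x.
have [C1f gradf] : C1 f /\ grad f = fun x =>
    expR (dot (D *m y) x) *: (row_vec i + dot (row_vec i) x *: (D *m y)).
  exact: expR_dot_mul_C1.
have yd : `|D *m y| <= d by exact: mulmx_sphere_le.
have bound s : `|(\int[mu_ s]_(x in S) dot (sgrad f x) (W x))%R| <= c.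
  apply: Rintegral_sphere_le => //; first exact: continuous_sgrad_dot.
  move=> x Sx; rewrite /sgrad (le_trans (dot_Pperp_le _ _ Sx))//.
  have x1 := sphere_norm_le1 Sx.
  rewrite ler_wpM2l ?addr_ge0 ?mulr_ge0// ler_pM ?hw//.
  rewrite gradf normrZ ger0_norm ?expR_ge0// ler_pM ?expR_ge0//.
    rewrite ler_expR (le_trans (ler_norm _))// (le_trans (dot_norm_le _ _))//.
    by rewrite ler_wpM2l// (le_trans _ yd)// ler_piMr.
  rewrite (le_trans (ler_normD _ _))// lerD ?row_vec_le// normrZ ler_pM//.
  rewrite (le_trans (dot_norm_le _ _))// ler_wpM2l//.
  by rewrite (le_trans _ (row_vec_le i))// ler_piMr.
have := bounded_derive_lipschitz (dmu C1f) bound 0 t.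
rewrite subr0; congr (`|_| <= _).
by rewrite -/(f _) -!potential_grad_test !mxE.
Qed.

(** Freezing one of the two arguments of the (symmetric) energy at time [0]
    leaves an error quadratic in [t]: the potentials at times [0] and [t]
    differ by [O(t)] together with their gradients, and so do the measures
    tested against them. *)
Lemma energy_remainder : exists C, forall t,
  `|(energy D (mu_ t) - 2 * (\int[mu_ t]_(x in S) potential D (mu_ 0) x)%R)
   - (energy D (mu_ 0) - 2 * (\int[mu_ 0]_(x in S) potential D (mu_ 0) x)%R)|
  <= C * t ^+ 2.
Proof.
have [w w0 hw] := field_bounded_sphere.
have [c c0 hc] := potential_grad_variation.
pose K : R := n%:R + n%:R * n%:R.
have K0 : 0 <= K by rewrite addr_ge0// mulr_ge0.
exists (K * (c * w)) => t.
have [C1t gradt] := potential_C1 D (muS t).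
have [C10 grad0] := potential_C1 D (muS 0).
pose g s := (\int[mu_ s]_(x in S) dot (sgrad (potential D (mu_ t)) x) (W x))%R
  - (\int[mu_ s]_(x in S) dot (sgrad (potential D (mu_ 0)) x) (W x))%R.
have dg s : is_derive s (1 : R)
    (fun s => (\int[mu_ s]_(x in S) potential D (mu_ t) x)%R
     - (\int[mu_ s]_(x in S) potential D (mu_ 0) x)%R) (g s).
  exact: (is_deriveB (dmu C1t s) (dmu C10 s)).
have gb s : `|g s| <= K * (c * `|t| * w).
  rewrite /g -Rintegral_sphereB; [|exact: continuous_sgrad_dot..].
  apply: Rintegral_sphere_le => // [|x Sx].
    by apply: continuous_sub; exact: continuous_sgrad_dot.
  rewrite /sgrad -dotBl -mulmxBr (le_trans (dot_Pperp_le _ _ Sx))//.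
  by rewrite ler_wpM2l// ler_pM ?hw// gradt grad0 hc.
have := bounded_derive_lipschitz dg gb 0 t.
(* By duality the two mixed terms agree, so the left-hand side is the increment
   between [0] and [t] of the integral of the fixed function
   [potential D (mu_ t) - potential D (mu_ 0)] against [mu_ s]. *)
rewrite subr0 !(energyE D_sym) (potential_duality D_sym (muS t) (muS 0)).
rewrite -(real_normK (num_real t)) => h.
have -> : K * (c * w) * `|t| ^+ 2 = K * (c * `|t| * w) * `|t| by ring.
apply: le_trans h; rewrite le_eqVlt; apply/orP; left; apply/eqP; congr `|_|; ring.
Qed.

(** The potential of the initial measure stays fixed in the linear part, to
    which the weak equation applies directly; the factor [2] is the symmetry of
    the energy. *)
Lemma energy_derivative : is_derive (0 : R) (1 : R)
  (fun t => energy D (mu_ t))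
  (2 * (\int[mu]_(x in S) dot (sgrad (potential D mu) x) (W x))%R).
Proof.
have [C hC] := energy_remainder.
have mu0 : forall A : set (borelE R n), measurable A -> mu_ 0 A = mu A.
  by have [] := pert.
have potE : potential D (mu_ 0) = potential D mu.
  by apply/funext => x; exact: Rintegral_eq_measure.
have [C10 _] := potential_C1 D (muS 0).
have d1 := dmu C10 0.
pose r t := energy D (mu_ t) - 2 * (\int[mu_ t]_(x in S) potential D (mu_ 0) x)%R.
have d2 := @is_derive_quadratic _ r C hC.
have d3 := is_deriveD d2 (is_deriveZ 2 d1).
rewrite add0r (Rintegral_eq_measure _ mu0) potE in d3.
move: d3; rewrite /GRing.scale/=.
have -> : r + 2 \*: (fun s => (\int[mu_ s]_(x in S) potential D mu x)%R) =
    (fun t => energy D (mu_ t)).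
  by apply/funext => t; rewrite /r potE !fctE /GRing.scale/= subrK.
by [].
Qed.

End first_variation.

(** * Critical points *)

Section critical_points.
Variables (R : realType) (n : nat) (D V : 'M[R]_n).
Hypotheses (D_sym : D^T = D) (VD : V = D \/ V = - D).
Local Notation vec := 'cV[R]_n.
Local Notation S := (sphere R n).
Variable mu : probability (borelE R n) R.
Hypothesis muS : on_sphere mu.

Let pot := potential D mu.
Let C1pot : C1 pot. Proof. exact: (potential_C1 D muS).1. Qed.
Let sgradE x : sgrad pot x = Pperp x *m potential_grad D mu x.
Proof. by rewrite /sgrad (potential_C1 D muS).2. Qed.

(** The sign of [V] and the normalisation only rescale the tangential gradient
    of the potential. *)
Lemma velocityE : exists2 e : R, e != 0 &
  forall x, velocity D V mu x = (e * (pot x)^-1) *: sgrad pot x.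
Proof.
case: VD => ->.
  by exists 1 => [|x]; rewrite ?oner_eq0// mul1r sgradE.
exists (-1) => [|x]; first by rewrite oppr_eq0 oner_eq0.
rewrite mulrC -scalerA scaleN1r sgradE /velocity -mulmxN.
congr (_ *: (_ *m _)); apply: eq_col => i; rewrite !mxE.
rewrite -[RHS]mulN1r -Rintegral_sphereZ; last exact: continuous_kernel_coord.
by apply: eq_Rintegral => y _; rewrite mulNmx [in LHS]mxE mulrN mulN1r.
Qed.

(** The weight [f] is [1] for the first variation and the inverse of the
    potential for stationarity. *)
Lemma sgrad_ae_of_integral (f : vec -> R) : continuous f ->
  (forall x, S x -> 0 < f x) ->
  (\int[mu]_(x in S) (f x * dot (sgrad pot x) (sgrad pot x)))%R = 0 ->
  {ae mu, forall x, S x -> sgrad pot x = 0}.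
Proof.
move=> cf f0 h.
have cg := continuous_sgrad_dot C1pot (continuous_sgrad C1pot).
have := Rintegral_sphere_eq0 (continuous_mul cf cg) _ h.
move=> /(_ (fun x Sx => mulr_ge0 (ltW (f0 x Sx)) (dotxx_ge0 _))).
apply: ae_imply => x hx Sx; apply: dotxx_eq0.
by have /eqP := hx Sx; rewrite mulf_eq0 gt_eqF ?f0//= => /eqP.
Qed.

Lemma integral_of_sgrad_ae (v : vec -> vec) : continuous v ->
  {ae mu, forall x, S x -> sgrad pot x = 0} ->
  (\int[mu]_(x in S) dot (sgrad pot x) (v x))%R = 0.
Proof.
move=> cv h; rewrite -[RHS](Rintegral_sphere_cst muS 0).
apply: Rintegral_sphere_ae; first exact: continuous_sgrad_dot.
  by move=> x; exact: cst_continuous.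
by apply: ae_imply h => x hx Sx; rewrite hx// -(scale0r 0) dotZl mul0r.
Qed.

Let cpotV : continuous (fun x => (pot x)^-1).
Proof.
move=> x; apply: (@continuousV _ _ pot x).
  by rewrite gt_eqF// potential_gt0.
exact: C1_continuous.
Qed.

(** The potential itself is the decisive test function. *)
Lemma stationary_iff_sgrad_ae :
  stationary D V mu <-> {ae mu, forall x, S x -> sgrad pot x = 0}.
Proof.
have [e e0 vE] := velocityE; split=> [st|h phi C1phi].
  apply: (sgrad_ae_of_integral cpotV) => [x _|].
    by rewrite invr_gt0 potential_gt0.
  have := st _ C1pot.
  under eq_Rintegral do rewrite vE dotZr -mulrA.
  rewrite Rintegral_sphereZ; last first.
    apply: continuous_mul; first exact: cpotV.
    exact: continuous_sgrad_dot C1pot (continuous_sgrad C1pot).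
  by move/eqP; rewrite mulf_eq0 (negbTE e0) => /eqP.
under eq_Rintegral do rewrite vE dotZr dotC -dotZr.
apply: integral_of_sgrad_ae h => x.
apply: (@continuousZ _ _ _ (fun x => e * (pot x)^-1) (sgrad phi)).
  by apply: continuous_mul => //; exact: cst_continuous.
exact: continuous_sgrad.
Qed.

(** The decisive field is the gradient of the potential, cut off at infinity. *)
Lemma first_variation_iff_sgrad_ae :
  (forall W : vec -> vec, [lipschitz W x | x in [set: vec]] ->
     is_first_variation D mu W 0) <->
  {ae mu, forall x, S x -> sgrad pot x = 0}.
Proof.
split=> [h|h W lW]; last first.
  split=> [|mu_ pert]; first exact: perturbation_exists.
  have := energy_derivative D_sym lW pert.
  by rewrite integral_of_sgrad_ae ?mulr0//; exact: lipschitz_continuous.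
have [L [M [L0 M0 bW lW]]] := cutoff_lipschitz (potential_grad_lip D muS 2).
pose W x := cutoff x *: potential_grad D mu x.
have {}lW : [lipschitz W x | x in [set: vec]].
  have pf : ProperFilter (globally ([set: vec] `*` [set: vec])).
    exact: (@globally_properfilter _ _ (0, 0)).
  by apply: (@klipschitzW _ _ _ L) => -[x y] _ /=; exact: lW.
have [[mu_ pert] hd] := h W lW.
have [_ d1] := energy_derivative D_sym lW pert; have [_ d2] := hd mu_ pert.
apply: (@sgrad_ae_of_integral (fun=> 1)) => //.
  by move=> x; exact: cst_continuous.
have : 2 * (\int[mu]_(x in S) dot (sgrad pot x) (W x))%R = 0.
  exact: etrans (esym d1) d2.
move/eqP; rewrite mulf_eq0 pnatr_eq0/= => /eqP hW.
rewrite -[RHS]hW; apply: eq_Rintegral => x /set_mem Sx.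
rewrite mul1r /W cutoff_unit ?scale1r; last exact: sphere_norm_le1.
by rewrite sgradE -dot_Pperp_idem.
Qed.

End critical_points.

Theorem lemma4p3 (R : realType) (n : nat) (D V : 'M[R]_n)
    (D_sym : D^T = D) (VD : V = D \/ V = - D)
    (mu : probability (borelE R n) R) (mu_sphere : on_sphere mu) :
  stationary D V mu <->
  (forall W : 'cV[R]_n -> 'cV[R]_n,
     [lipschitz W x | x in [set: 'cV[R]_n]] -> is_first_variation D mu W 0).
Proof.
apply: iff_trans (stationary_iff_sgrad_ae VD mu_sphere) _.
exact: iff_sym (first_variation_iff_sgrad_ae D_sym mu_sphere).
Qed.
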